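(* Let $\alpha,\beta,\gamma,\delta>-1$. Let $f,h\in C^2(\mathrm T)$ be real-valued, and set $g=f\circ\Psi$ and $q=h\circ\Psi$. Then $$\langle \widetilde{\mathcal L}f,h\rangle_{L^2(\mathrm T,W)}=\langle \mathcal L g,q\rangle_{L^2(Q,\mathcal W)}.$$ Consequently $\widetilde{\mathcal L}$ is symmetric and nonnegative on $C^2(\mathrm T)$ with respect to the weighted inner product of $L^2(\mathrm T,W)$, i.e. $\langle \widetilde{\mathcal L}f,h\rangle_{L^2(\mathrm T,W)}=\langle f,\widetilde{\mathcal L}h\rangle_{L^2(\mathrm T,W)}$ and $\langle \widetilde{\mathcal L}f,f\rangle_{L^2(\mathrm T,W)}\ge 0$. Moreover, $$\langle \widetilde{\mathcal L}f,f\rangle_{L^2(\mathrm T,W)}=\int_{\mathrm T}|\Phi_x(x,y)\,\partial_xf(x,y)|^2\,W(x,y)\,dx\,dy+\int_{\mathrm T}|\Phi_y(x,y)\,D_yf(x,y)|^2\,W(x,y)\,dx\,dy.$$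
   Context: The trapezoid is $\mathrm T=\{(x,y)\in\mathbb R^2:0\le y\le 1,\ 0\le x\le 2-y\}$, $Q=[0,1]^2$, and $\Psi:Q\to\mathrm T$ is the bijection $\Psi(s,t)=((2-t)s,\,t)$. For parameters $\alpha,\beta,\gamma,\delta>-1$: - $W(x,y)=x^\gamma(2-x-y)^\delta y^\alpha(1-y)^\beta(2-y)^{-(\gamma+\delta+1)}$ on $\mathrm T$; - $w_{a,b}(r)=r^a(1-r)^b$ and $\mathcal W(s,t)=w_{\gamma,\delta}(s)\,w_{\alpha,\beta}(t)$ on $Q$; - $\langle u,v\rangle_{L^2(\mathrm T,W)}=\int_{\mathrm T}uv\,W\,dx\,dy$ and $\langle u,v\rangle_{L^2(Q,\mathcal W)}=\int_Q uv\,\mathcal W\,ds\,dt$. For $a,b>-1$ the Jacobi Sturm–Liouville expression is $$\mathcal J_r(w_{a,b},h)=-\frac{1}{w_{a,b}(r)}\frac{d}{dr}\Big(w_{a,b}(r)\,r(1-r)\,h'(r)\Big)=-r(1-r)h''(r)-\big(a+1-(a+b+2)r\big)h'(r).$$ On the square, $\mathcal L g(s,t)=\mathcal J_s(w_{\gamma,\delta},g(\cdot,t))+\mathcal J_t(w_{\alpha,\beta},g(s,\cdot))$, where $\mathcal J_s$ acts in the variable $s$ and $\mathcal J_t$ in the variable $t$. On the trapezoid, $\widetilde{\mathcal L}f=\mathcal L(f\circ\Psi)\circ\Psi^{-1}$ for $f\in C^2(\mathrm T)$. Further, $\Phi_x(x,y)=\sqrt{x(2-x-y)}$, $\Phi_y(x,y)=\sqrt{y(1-y)}$,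 and $D_yf=\partial_yf-\frac{x}{2-y}\,\partial_xf$. *)

(* Defs.v *)
From HB Require Import structures.
From mathcomp Require Import all_boot all_order all_algebra.
From mathcomp Require Import all_classical all_reals all_analysis.
From mathcomp Require Import ring lra.

Set Implicit Arguments.
Unset Strict Implicit.
Unset Printing Implicit Defensive.

Import Order.TTheory GRing.Theory Num.Theory.
Import numFieldNormedType.Exports.

Local Open Scope classical_set_scope.
Local Open Scope ring_scope.

(* The derivative up to the boundary: the directional derivative is taken in the
   interior of D and extended to D by continuity.  It only depends on the values
   of f on the interior of D. *)
Definition cderive (R : realType) (V : normedModType R) (D : set V) (v : V)
    (f : V -> R) (p : V) : R :=
  lim ('D_v f z @[z --> within (D°) (nbhs p)]).

(* C^k (D) for a set D which is the closure of its interior (as the trapezoid and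
   the square are): f is continuous on D, its two partial derivatives exist in
   the interior, extend continuously to D, and the extensions are C^(k-1) (D).
   For p in the interior, the convergence condition says that the partial
   derivative is continuous at p. *)
Fixpoint Ck (R : realType) (k : nat) (D : set (R * R)) (f : R * R -> R) : Prop :=
  {within D, continuous f} /\
  (if k is k'.+1 then
     forall v : R * R, v = (1, 0) \/ v = (0, 1) ->
       [/\ forall p, D° p -> derivable f p v,
           forall p, D p -> cvg ('D_v f z @[z --> within (D°) (nbhs p)]) &
           Ck k' D (cderive D v f)]
   else True).

Definition trapezoid (R : realType) : set (R * R) :=
  [set p | 0 <= p.2 <= 1 /\ 0 <= p.1 <= 2 - p.2].

Definition square (R : realType) : set (R * R) :=
  [set p | 0 <= p.1 <= 1 /\ 0 <= p.2 <= 1].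

Definition Psi (R : realType) (p : R * R) : R * R := ((2 - p.2) * p.1, p.2).

Definition PsiV (R : realType) (p : R * R) : R * R := (p.1 / (2 - p.2), p.2).

Definition wT (R : realType) (al be ga de : R) (p : R * R) : R :=
  p.1 `^ ga * (2 - p.1 - p.2) `^ de * p.2 `^ al * (1 - p.2) `^ be *
  (2 - p.2) `^ (- (ga + de + 1)).

Definition w (R : realType) (a b : R) (r : R) : R := r `^ a * (1 - r) `^ b.

Definition wQ (R : realType) (al be ga de : R) (p : R * R) : R :=
  w ga de p.1 * w al be p.2.

Definition lebesgue2 (R : realType) :=
  (@lebesgue_measure R \x @lebesgue_measure R)%E.

Definition inner (R : realType) (D : set (R * R)) (W u v : R * R -> R) : R :=
  \int[@lebesgue2 R]_(p in D) (u p * v p * W p).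

Definition in_L2 (R : realType) (D : set (R * R)) (W u : R * R -> R) : Prop :=
  measurable_fun D u /\
  (@lebesgue2 R).-integrable D (fun p => (u p ^+ 2 * W p)%:E).

Definition unit_itv (R : realType) : set R := `[0, 1]%classic.

(* The expanded form of the Jacobi expression, meaningful on all of [0, 1];
   see jacobi_div for the divergence form. *)
Definition jacobi (R : realType) (a b : R) (h : R -> R) (r : R) : R :=
  let I := @unit_itv R in
  - (r * (1 - r) * cderive I 1 (cderive I 1 h) r)
  - (a + 1 - (a + b + 2) * r) * cderive I 1 h r.

Definition LQ (R : realType) (al be ga de : R) (g : R * R -> R) (p : R * R) : R :=
  jacobi ga de (fun s => g (s, p.2)) p.1 + jacobi al be (fun t => g (p.1, t)) p.2.

Definition LT (R : realType) (al be ga de : R) (f : R * R -> R) : R * R -> R :=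
  LQ al be ga de (f \o @Psi R) \o @PsiV R.

Definition Phix (R : realType) (p : R * R) : R := Num.sqrt (p.1 * (2 - p.1 - p.2)).

Definition Phiy (R : realType) (p : R * R) : R := Num.sqrt (p.2 * (1 - p.2)).

Definition dx (R : realType) (f : R * R -> R) : R * R -> R :=
  cderive (@trapezoid R) (1, 0) f.

Definition dy (R : realType) (f : R * R -> R) : R * R -> R :=
  cderive (@trapezoid R) (0, 1) f.

Definition Dy (R : realType) (f : R * R -> R) (p : R * R) : R :=
  dy f p - p.1 / (2 - p.2) * dx f p.

Lemma Psi_trapezoid (R : realType) (p : R * R) :
  square p -> trapezoid (Psi p) /\ PsiV (Psi p) = p.
Proof.
case: p => s t [/= /andP[s0 s1] /andP[t0 t1]]; split.
  rewrite /trapezoid /Psi /=; split; first by rewrite t0 t1.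
  by apply/andP; split; nra.
by rewrite /PsiV /Psi /=; congr pair; field; lra.
Qed.

Lemma PsiV_square (R : realType) (p : R * R) :
  trapezoid p -> square (PsiV p) /\ Psi (PsiV p) = p.
Proof.
case: p => x y [/= /andP[y0 y1] /andP[x0 x1]]; split.
  rewrite /square /PsiV /=; split; last by rewrite y0 y1.
  have h : 0 < 2 - y by lra.
  by rewrite divr_ge0 ?(ltW h)//= ler_pdivrMr// mul1r.
by rewrite /PsiV /Psi /=; congr pair; field; lra.
Qed.

Lemma cderive_interior (R : realType) (V : normedModType R) (D : set V) (v : V)
    (f : V -> R) (p : V) :
  D° p -> {for p, continuous ('D_v f)} -> cderive D v f p = 'D_v f p.
Proof.
move=> Dp cf; rewrite /cderive within_interior; last first.
  by have /interior_id -> := @open_interior _ D.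
exact: (cvg_lim (@Rhausdorff R)).
Qed.

Lemma jacobi_div (R : realType) (a b : R) (h : R -> R) :
  {in `]0, 1[, forall s : R, derivable h s 1 /\ derivable (derive1 h) s 1} ->
  {in `]0, 1[, continuous (derive1 (derive1 h))} ->
  {in `]0, 1[, forall r : R, jacobi a b h r =
  - (w a b r)^-1 * derive1 (fun s => w a b s * (s * (1 - s)) * derive1 h s) r}.
Proof.
move=> dh ch r rI.
have ih (s : R) : s \in `]0, 1[ -> (@unit_itv R)° s.
  by rewrite /unit_itv interior_itv.
have E1 (s : R) : s \in `]0, 1[ -> cderive (@unit_itv R) 1 h s = (derive1 h) s.
  move=> sI; rewrite cderive_interior ?derive1E//; first exact: ih.
  have := (dh s sI).2 => /derivable1_diffP/differentiable_continuous.
  by rewrite (_ : (derive1 h) = 'D_1 h)//; apply/funext => z; rewrite derive1E.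
have nI (s : R) : s \in `]0, 1[ -> \forall z \near s, z \in `]0, 1[.
  by move=> sI; apply: near_in_itvoo.
have E2' (s : R) : s \in `]0, 1[ -> 'D_1 (cderive (@unit_itv R) 1 h) s = (derive1 (derive1 h)) s.
  move=> sI; rewrite derive1E; apply: near_eq_derive.
  by near=> z; apply: E1; near: z; exact: nI.
have E2 : cderive (@unit_itv R) 1 (cderive (@unit_itv R) 1 h) r = (derive1 (derive1 h)) r.
  rewrite cderive_interior ?E2'//; first exact: ih.
  rewrite /prop_for /continuous_at E2'//.
  have := ch r rI; apply: cvg_trans; apply: near_eq_cvg.
  by near=> z; apply/esym/E2'; near: z; exact: nI.
rewrite /jacobi E1// E2.
move: (rI); rewrite in_itv/= => /andP[r0 r1].
have r1' : 0 < 1 - r by lra.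
have [d1 d2] := dh r rI.
have Da : is_derive r 1 (fun s : R => s `^ a) (a * r `^ (a - 1)).
  exact: is_derive1_powR.
have Db : is_derive r 1 (fun s : R => (1 - s) `^ b) (- (b * (1 - r) `^ (b - 1))).
  have D1 : is_derive r 1 (fun s : R => 1 - s) (- 1).
    have := is_deriveB (is_derive_cst (1 : R) r 1) (is_derive_id r 1).
    by rewrite sub0r.
  have := @is_derive1_comp R (fun s => s `^ b) (fun s => 1 - s) r _ _
    (is_derive1_powR b r1') D1.
  by rewrite mulrN1.
have Dp : is_derive r 1 (fun s : R => s * (1 - s)) (1 - 2 * r).
  apply: (is_derive_eq (is_deriveM (is_derive_id r 1)
    (is_deriveB (is_derive_cst (1 : R) r 1) (is_derive_id r 1)))).
  by rewrite /GRing.scale/= !fctE /cst /=; ring.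
have Dh : is_derive r 1 (derive1 h) ((derive1 (derive1 h)) r).
  by split => //; rewrite derive1E.
have Dw := is_deriveM (is_deriveM (is_deriveM Da Db) Dp) Dh.
rewrite [in RHS]derive1E.
have -> : 'D_1 (fun s => w a b s * (s * (1 - s)) * (derive1 h) s) r = _ := @derive_val _ _ _ _ _ _ _ Dw.
rewrite /w /GRing.scale /= !fctE.
have pa : r `^ (a - 1) = r `^ a / r by rewrite powRB ?powRr1 ?(ltW r0) ?(gt_eqF r0) ?implybT.
have pb : (1 - r) `^ (b - 1) = (1 - r) `^ b / (1 - r).
  by rewrite powRB ?powRr1 ?(ltW r1') ?(gt_eqF r1') ?implybT.
rewrite pa pb; have := powR_gt0 a r0; have := powR_gt0 b r1'.
move=> B0 A0; field; do ?[apply/andP; split]; lra.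
Unshelve. all: by end_near. Qed.

(* Main.v *)
Require Import Defs.
From HB Require Import structures.
From mathcomp Require Import all_boot all_order all_algebra.
From mathcomp Require Import all_classical all_reals all_analysis.
From mathcomp Require Import measurable_realfun ring lra.

(** The map Psi sends the square onto the trapezoid and is affine in each
variable, with Jacobian 2 - t, which together with the factor
(2 - y)^-(ga + de + 1) turns the weight of the trapezoid into the product of the
two Jacobi weights.  The chain rule gives d/ds (f o Psi) = (2 - t) dx f and
d/dt (f o Psi) = Dy f at Psi (s, t), so the energy identity on the trapezoid is
the one on the square.  There, Fubini reduces it to one variable, where the flux
r^(a+1) (1-r)^(b+1) u'(r) v(r) vanishes at both ends because a, b > -1, hence
integration by parts leaves no boundary term.  Since f is only differentiated in
the interior, its derivatives are carried to the edges of the square by the mean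
value theorem and the continuity of the extended derivatives. *)

Import Order.TTheory GRing.Theory Num.Theory.
Import numFieldNormedType.Exports.
Local Open Scope classical_set_scope.
Local Open Scope ring_scope.

Set Implicit Arguments.
Unset Strict Implicit.
Unset Printing Implicit Defensive.

(** * Directional derivatives from continuous partial derivatives *)

(** What a derivative means at the boundary shapes the first half. [Ck] supplies derivatives along
    the two axes only, while the vertical segments of the square are carried to slanted segments of
    direction (-s, 1), so directional derivatives have to be assembled from the partial ones.
    Moreover [cderive] on the unit interval sees one slice at a time, and a slice along an edge,
    such as t = 0, never meets the interior of the square. These edge slices count: [LQ] is
    evaluated on the closed square, its continuity there gives square integrability, and the
    integration by parts is carried out on every row and column, edges included.

    Negative exponents make the weights unbounded, so the derivative of the flux may blow up at the
    endpoints. The fundamental theorem is therefore proved on the open interval by exhaustion, the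
    primitive alone being continuous up to the ends; applied to an explicit primitive, it also gives
    the integrability of the weights. *)

(** The slope L is fixed in advance and the error e is uniform, so the bound can be added along a
    broken path or passed to the limit in a parameter. Balls around x avoid ordering x and y. *)
Lemma mean_value_bound (R : realType) (f df : R -> R) (L e x y : R) :
  (forall z, `|z - x| <= `|y - x| -> is_derive z 1 f (df z)) ->
  (forall z, `|z - x| <= `|y - x| -> `|df z - L| <= e) ->
  `|f y - f x - L * (y - x)| <= e * `|y - x|.
Proof.
move=> hf he.
have bd z : z \in `[Num.min x y, Num.max x y] -> `|z - x| <= `|y - x|.
  rewrite in_itv/= => /andP[].
  by have [xy|yx] := leP x y => ? ?;
    [rewrite !ger0_norm| rewrite !ler0_norm]; lra.
have mM : Num.min x y <= Num.max x y by rewrite ge_min !le_max !lexx.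
have cf : {within `[Num.min x y, Num.max x y], continuous f}.
  by apply: derivable_within_continuous => z /bd/hf[].
have dF z : z \in `]Num.min x y, Num.max x y[ -> is_derive z 1 f (df z).
  by move=> /subset_itv_oo_cc/bd/hf.
have [z /bd/he hz E] := MVT_segment mM dF cf.
suff -> : f y - f x - L * (y - x) = (df z - L) * (y - x).
  by rewrite normrM ler_wpM2r.
by move: E; have [xy|yx] := leP x y; lra.
Qed.

Lemma is_derive_eps (R : realType) (V : normedModType R) (f : V -> R) (a v : V)
    (L : R) :
  (forall e : R, 0 < e -> \forall h \near (0 : R),
     `|f (h *: v + a) - f a - L * h| <= e * `|h|) ->
  is_derive a v f L.
Proof.
move=> H.
have C : (fun h => h^-1 *: ((f \o shift a) (h *: v) - f a)) @ 0^' --> L.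
  apply/cvgrPdist_le => e e0; near=> h.
  have h0 : h != 0 by near: h; exact: nbhs_dnbhs_neq.
  rewrite distrC.
  have -> : h^-1 *: ((f \o shift a) (h *: v) - f a) - L =
     (f (h *: v + a) - f a - L * h) / h.
    by rewrite /= /GRing.scale/=; field.
  rewrite normrM normfV ler_pdivrMr ?normr_gt0//.
  near: h; apply: (@nbhs_dnbhs R); exact: H.
split; first by apply/cvg_ex; exists L.
exact: (cvg_lim (@Rhausdorff R)).
Unshelve. all: by end_near. Qed.

(** The two difference quotients are the same function of h. Derivatives along any line of the plane
    thus become derivatives in one variable. *)
Lemma is_derive_line (R : realType) (V : normedModType R) (f : V -> R)
    (a v : V) (t L : R) :
  is_derive t 1 (fun s : R => f (s *: v + a)) L <-> is_derive (t *: v + a) v f L.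
Proof.
set g := fun s : R => f (s *: v + a).
set F := fun h : R => h^-1 *: ((g \o shift t) (h *: 1) - g t).
set G := fun h : R => h^-1 *: ((f \o shift (t *: v + a)) (h *: v) - f (t *: v + a)).
have E : F = G.
  apply/funext => h; rewrite /F /G /g /=; congr (_ *: (f _ - _)).
  by rewrite addrA -scalerDl /GRing.scale/= mulr1.
split=> -[d1 d2]; split.
- by change (cvg (G @ 0^')); rewrite -E.
- by change (lim (G @ 0^') = L); rewrite -E.
- by change (cvg (F @ 0^')); rewrite E.
- by change (lim (F @ 0^') = L); rewrite E.
Qed.

Lemma is_derive_fst (R : realType) (f : R * R -> R) (x y L : R) :
  is_derive x 1 (fun s => f (s, y)) L <-> is_derive (x, y) (1, 0) f L.
Proof.
have E (s : R) : (s, y) = s *: (1, 0) + (0, y) :> R * R.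
  by congr pair; rewrite /= /GRing.scale/=; ring.
rewrite [X in is_derive X _ f L]E -is_derive_line.
by under eq_fun do rewrite E.
Qed.

Lemma is_derive_snd (R : realType) (f : R * R -> R) (x y L : R) :
  is_derive y 1 (fun s => f (x, s)) L <-> is_derive (x, y) (0, 1) f L.
Proof.
have E (s : R) : (x, s) = s *: (0, 1) + (x, 0) :> R * R.
  by congr pair; rewrite /= /GRing.scale/=; ring.
rewrite [X in is_derive X _ f L]E -is_derive_line.
by under eq_fun do rewrite E.
Qed.

Lemma is_derive_dir (R : realType) (f : R * R -> R) (a b : R) (p : R * R) :
  (\forall z \near p, derivable f z (1, 0) /\ derivable f z (0, 1)) ->
  {for p, continuous ('D_(1, 0) f)} -> {for p, continuous ('D_(0, 1) f)} ->
  is_derive p (a, b) f (a * 'D_(1, 0) f p + b * 'D_(0, 1) f p).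
Proof.
case: p => x y df c1 c2; apply: is_derive_eps => e e0.
(* The two legs of the path below contribute at most e' (|a| + |b|) |h| in total; the added 1 keeps
   the denominator positive for the zero direction. *)
pose e' := e / (`|a| + `|b| + 1).
have M0 : 0 < `|a| + `|b| + 1 by rewrite ltr_wpDl// addr_ge0.
have e'0 : 0 < e' by rewrite divr_gt0.
have /nbhs_ballP[d /= d0 hd] : \forall z \near (x, y),
    (derivable f z (1, 0) /\ derivable f z (0, 1)) /\
    (`|'D_(1, 0) f z - 'D_(1, 0) f (x, y)| <= e' /\
     `|'D_(0, 1) f z - 'D_(0, 1) f (x, y)| <= e').
  have n1 : \forall z \near (x, y), `|'D_(1, 0) f z - 'D_(1, 0) f (x, y)| <= e'.
    exact: cvgr_distC_le c1 _ e'0.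
  have n2 : \forall z \near (x, y), `|'D_(0, 1) f z - 'D_(0, 1) f (x, y)| <= e'.
    exact: cvgr_distC_le c2 _ e'0.
  exact: filterS3 (fun z P1 P2 P3 => conj P1 (conj P2 P3)) df n1 n2.
have hd' s t : `|s - x| < d -> `|t - y| < d -> ball (x, y) d (s, t).
  by move=> ? ?; split; rewrite /ball/= distrC.
near=> h.
have hM : `|h| * (`|a| + `|b| + 1) < d.
  rewrite -ltr_pdivlMr//; near: h.
  by apply: (@pseudometric_normed_Zmodule.nbhs0_lt R R); rewrite divr_gt0.
have [ha hb] : `|h * a| < d /\ `|h * b| < d.
  rewrite !normrM; split; apply: le_lt_trans hM; rewrite ler_wpM2l//.
    by rewrite -addrA lerDl addr_ge0.
  by rewrite addrAC lerDr addr_ge0.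
rewrite [X in f X - _](_ : _ = (x + h * a, y + h * b)); last first.
  by congr pair; rewrite /= /GRing.scale/=; ring.
(* The increment is split at the corner (x, y + h b): [B2] bounds the vertical leg and [B1] the
   horizontal one. Each leg is parallel to an axis and stays in the ball where the partial
   derivatives vary by at most e'. *)
have B1 := @mean_value_bound _ (fun s => f (s, y + h * b))
  (fun s => 'D_(1, 0) f (s, y + h * b)) ('D_(1, 0) f (x, y)) e' x (x + h * a).
have B2 := @mean_value_bound _ (fun s => f (x, s))
  (fun s => 'D_(0, 1) f (x, s)) ('D_(0, 1) f (x, y)) e' y (y + h * b).
have addKl (u v : R) : u + v - u = v by rewrite addrAC subrr add0r.
rewrite !addKl in B1 B2.
have {}B1 : `|f (x + h * a, y + h * b) - f (x, y + h * b)
     - 'D_(1, 0) f (x, y) * (h * a)| <= e' * `|h * a|.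
  apply: B1 => z zx.
    apply/is_derive_fst; apply: DeriveDef; last reflexivity.
    by apply: (hd (z, _) _).1.1; apply: hd'; [exact: le_lt_trans ha|rewrite addKl].
  by apply: (hd (z, _) _).2.1; apply: hd'; [exact: le_lt_trans ha|rewrite addKl].
have {}B2 : `|f (x, y + h * b) - f (x, y)
     - 'D_(0, 1) f (x, y) * (h * b)| <= e' * `|h * b|.
  apply: B2 => z zx.
    apply/is_derive_snd; apply: DeriveDef; last reflexivity.
    by apply: (hd (x, _) _).1.2; apply: hd'; [rewrite subrr normr0|exact: le_lt_trans hb].
  by apply: (hd (x, _) _).2.2; apply: hd'; [rewrite subrr normr0|exact: le_lt_trans hb].
have -> : f (x + h * a, y + h * b) - f (x, y) -
   (a * 'D_(1, 0) f (x, y) + b * 'D_(0, 1) f (x, y)) * h =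
  (f (x + h * a, y + h * b) - f (x, y + h * b)
     - 'D_(1, 0) f (x, y) * (h * a)) +
  (f (x, y + h * b) - f (x, y) - 'D_(0, 1) f (x, y) * (h * b)) by ring.
apply: (le_trans (ler_normD _ _)); apply: (le_trans (lerD B1 B2)).
rewrite -mulrDr !normrM -mulrDr mulrCA mulrC ler_wpM2r//.
rewrite /e' mulrAC ler_pdivrMr// ler_pM2l//; lra.
Unshelve. all: by end_near. Qed.

(** * Derivatives up to the boundary of the square *)

Lemma within_cvg_map (X Y : topologicalType) (A : set X) (B : set Y)
    (phi : X -> Y) (p : X) :
  phi @ within A (nbhs p) --> phi p -> (forall z, A z -> B (phi z)) ->
  phi @ within A (nbhs p) --> within B (nbhs (phi p)).
Proof.
move=> cphi AB S /cphi; rewrite /nbhs/= /within/=.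
by apply: filterS => z h Az; apply: h => //; exact: AB.
Qed.

Lemma within_continuous_comp (X Y Z : topologicalType) (A : set X) (B : set Y)
    (phi : X -> Y) (f : Y -> Z) :
  {within A, continuous phi} -> {within B, continuous f} ->
  (forall z, A z -> B (phi z)) -> {within A, continuous (f \o phi)}.
Proof.
move=> /subspace_continuousP cphi /subspace_continuousP cf AB.
apply/subspace_continuousP => p Ap.
apply: cvg_comp (cf _ (AB _ Ap)).
by apply: within_cvg_map => //; exact: cphi.
Qed.

Section within_ring.
Variables (R : realType) (X : topologicalType) (A : set X).
Implicit Types f g : X -> R.

Lemma within_continuousD f g : {within A, continuous f} ->
  {within A, continuous g} -> {within A, continuous (fun p => f p + g p)}.
Proof. by move=> cf cg p; apply: cvgD; [exact: cf|exact: cg]. Qed.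

Lemma within_continuousM f g : {within A, continuous f} ->
  {within A, continuous g} -> {within A, continuous (fun p => f p * g p)}.
Proof. by move=> cf cg p; apply: cvgM; [exact: cf|exact: cg]. Qed.

Lemma within_continuousN f : {within A, continuous f} ->
  {within A, continuous (fun p => - f p)}.
Proof. by move=> cf p; apply: cvgN; exact: cf. Qed.

Lemma within_continuousB f g : {within A, continuous f} ->
  {within A, continuous g} -> {within A, continuous (fun p => f p - g p)}.
Proof. by move=> cf cg p; apply: cvgB; [exact: cf|exact: cg]. Qed.

End within_ring.

Lemma proper_within_oo (R : realType) (t : R) :
  0 <= t <= 1 -> ProperFilter (within `]0, 1[%classic (nbhs t)).
Proof.
move=> /andP[t0 t1]; apply: within_nbhs_proper => S /nbhs_ballP[e/= e0 eS].
(* A step of length m <= 1/4 from t towards the middle of the interval lands in the open interval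
   and stays within e of t. *)
pose m := Num.min e 1 / 4.
have m0 : 0 < m by rewrite /m divr_gt0// lt_min e0 ltr01.
have [me m1] : m < e /\ 4 * m <= 1.
  by rewrite /m; have [] := leP e 1; lra.
have [th|th] := leP t (1 / 2).
- exists (t + m); split; first by rewrite /= in_itv/=; lra.
  by apply: eS; rewrite /ball/= opprD addNKr normrN gtr0_norm.
- exists (t - m); split; first by rewrite /= in_itv/=; lra.
  by apply: eS; rewrite /ball/= opprB addrC subrK gtr0_norm.
Qed.

Lemma within_square_fst (R : realType) (f : R * R -> R) (t : R) : 0 <= t <= 1 ->
  {within @square R, continuous f} -> {within @unit_itv R, continuous (fun s => f (s, t))}.
Proof.
move=> t01 cf; apply: within_continuous_comp cf _.
  apply: continuous_subspaceT => s.
  by apply: (@cvg_pair _ _ _ _ (nbhs s) (nbhs t)); [exact: cvg_id|exact: cvg_cst].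
by move=> s; rewrite /unit_itv/= in_itv.
Qed.

Lemma within_square_snd (R : realType) (f : R * R -> R) (s : R) : 0 <= s <= 1 ->
  {within @square R, continuous f} -> {within @unit_itv R, continuous (fun t => f (s, t))}.
Proof.
move=> t01 cf; apply: within_continuous_comp cf _.
  apply: continuous_subspaceT => t.
  by apply: (@cvg_pair _ _ _ _ (nbhs s) (nbhs t)); [exact: cvg_cst|exact: cvg_id].
by move=> t; rewrite /unit_itv/= in_itv.
Qed.

(* On an edge t = 0 or t = 1 the derivative is obtained by letting t' -> t in the
   mean value bound for u (., t'), which is uniform in t' by continuity of v. *)
Lemma is_derive_square_fst (R : realType) (u v : R * R -> R) :
  {within @square R, continuous u} -> {within @square R, continuous v} ->
  (forall s t : R, 0 < s < 1 -> 0 < t < 1 ->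
    is_derive s 1 (fun z => u (z, t)) (v (s, t))) ->
  forall s t : R, 0 < s < 1 -> 0 <= t <= 1 ->
    is_derive s 1 (fun z => u (z, t)) (v (s, t)).
Proof.
move=> cu cv H s t s01 t01; apply: is_derive_eps => e e0.
have /andP[s0 s1] := s01.
have Qst : square (s, t) by split=> //=; rewrite !ltW.
have /nbhs_ballP[d /= d0 hd] : \forall z \near (s, t), square z ->
    `|v z - v (s, t)| <= e.
  move/subspace_continuousP : cv => /(_ _ Qst) cv.
  have : \forall z \near within (@square R) (nbhs (s, t)), `|v z - v (s, t)| <= e.
    exact: cvgr_distC_le cv _ e0.
  by rewrite near_withinE.
(* With |h| below this minimum, the segment from s to s + h stays in the open interval and within d
   of s. *)
have m0 : 0 < Num.min d (Num.min s (1 - s)) by rewrite !lt_min d0 s0/= subr_gt0.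
near=> h.
have : `|h| < Num.min d (Num.min s (1 - s)).
  by near: h; exact: (@pseudometric_normed_Zmodule.nbhs0_lt R R).
rewrite !lt_min => /and3P[hd1 hs0 hs1].
have hs (z : R) : `|z - s| <= `|h| -> 0 < z < 1.
  move=> /(le_lt_trans)/[dup] /(_ _ hs0) + /(_ _ hs1).
  by rewrite !ltr_norml => /andP[? ?] /andP[? ?]; lra.
have sh01 : 0 < s + h < 1 by apply: hs; rewrite addrAC subrr add0r.
have -> : h *: 1 + s = s + h by rewrite /GRing.scale/= mulr1 addrC.
have PF := proper_within_oo t01.
have cF (x : R) : 0 < x < 1 -> u (x, y) @[y --> within `]0, 1[%classic (nbhs t)] --> u (x, t).
  move=> x01; have x01' : 0 <= x <= 1 by case/andP: x01 => *; rewrite !ltW.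
  have /subspace_continuousP/(_ t) := within_square_snd x01' cu.
  rewrite /unit_itv/= in_itv => /(_ t01); apply: cvg_trans.
  by apply: cvg_app; apply: within_subset; apply: subset_itv_oo_cc.
have C : `|u (s + h, y) - u (s, y) - v (s, t) * h| @[y --> within `]0, 1[%classic (nbhs t)]
     --> `|u (s + h, t) - u (s, t) - v (s, t) * h|.
  apply: cvg_norm; apply: cvgB; last exact: cvg_cst.
  by apply: cvgB; apply: cF.
(* The desired inequality is closed, so it passes to the limit along interior rows y -> t; [PF]
   guarantees that this filter is proper, also when t is 0 or 1. *)
apply: (cvgr_to_le C).
have td : \forall y \near within `]0, 1[%classic (nbhs t), `|y - t| < d.
  apply: cvg_within; apply: filterS (nbhsx_ballx t _ d0) => y.
  by rewrite /ball/= distrC.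
near=> y.
have y01 : 0 < y < 1.
  suff : y \in `]0, 1[ by rewrite in_itv.
  by near: y; apply: withinT.
have yd : `|y - t| < d by near: y.
have := @mean_value_bound _ (fun z => u (z, y)) (fun z => v (z, y)) (v (s, t)) e s (s + h).
rewrite (addrAC s h (- s)) subrr add0r; apply.
  by move=> z zs; apply: H => //; exact: hs.
move=> z zs; apply: hd.
  by split; rewrite /ball/= distrC//; apply: le_lt_trans hd1.
have /andP[? ?] := hs _ zs; have /andP[? ?] := y01.
by split=> /=; rewrite !ltW.
Unshelve. all: by end_near. Qed.

Lemma is_derive_square_snd (R : realType) (u v : R * R -> R) :
  {within @square R, continuous u} -> {within @square R, continuous v} ->
  (forall s t : R, 0 < s < 1 -> 0 < t < 1 ->
    is_derive t 1 (fun z => u (s, z)) (v (s, t))) ->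
  forall s t : R, 0 <= s <= 1 -> 0 < t < 1 ->
    is_derive t 1 (fun z => u (s, z)) (v (s, t)).
Proof.
have csw : {within @square R, continuous (fun p : R * R => (p.2, p.1))}.
  apply: continuous_subspaceT => p.
  apply: (@cvg_pair _ _ _ _ (nbhs p.2) (nbhs p.1)); first exact: cvg_snd.
  exact: cvg_fst.
have swS (p : R * R) : square p -> square (p.2, p.1) by move=> -[].
move=> cu cv H s t s01 t01.
apply: (is_derive_square_fst (u := fun p => u (p.2, p.1)) (v := fun p => v (p.2, p.1))) => //.
- exact: (within_continuous_comp csw cu).
- exact: (within_continuous_comp csw cv).
- by move=> *; apply: H.
Qed.

(** The filter is that of full, not punctured, neighbourhoods, so every member contains p and the
    limit can only be f p. *)
Lemma cvg_continuous_at (R : realType) (X : topologicalType) (f : X -> R) (p : X) :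
  cvg (f @ nbhs p) -> {for p, continuous f}.
Proof.
move=> cf; rewrite /prop_for /continuous_at.
suff -> : f p = lim (f @ nbhs p) by [].
have [l fl] : exists l : R, f @ nbhs p --> l by apply/cvg_ex.
rewrite (cvg_lim (@Rhausdorff R) fl).
apply/eqP; rewrite -subr_eq0 -normr_le0; apply/ler_addgt0Pr => e e0; rewrite add0r.
have : \forall z \near p, `|f z - l| <= e by exact: cvgr_distC_le fl _ e0.
by move/nbhs_singleton.
Qed.

(** [cderive] only looks at derivatives in the open interval, where they equal v; continuity of v
    then gives the value at the two endpoints. *)
Lemma cderive_unit_itv (R : realType) (u v : R -> R) :
  {within @unit_itv R, continuous v} ->
  (forall s : R, 0 < s < 1 -> is_derive s 1 u (v s)) ->
  forall s : R, 0 <= s <= 1 ->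
    cderive (@unit_itv R) 1 u s = v s.
Proof.
move=> /subspace_continuousP cv H s s01; rewrite /cderive.
rewrite /unit_itv interior_itv.
have PF := proper_within_oo s01.
apply: (cvg_lim (@Rhausdorff R)).
have : v z @[z --> within `]0, 1[%classic (nbhs s)] --> v s.
  have := cv s; rewrite /unit_itv/= in_itv => /(_ s01); apply: cvg_trans.
  by apply: cvg_app; apply: within_subset; apply: subset_itv_oo_cc.
apply: cvg_trans; apply: near_eq_cvg.
near=> z; have z01 : z \in `]0, 1[ by near: z; apply: withinT.
by rewrite in_itv in z01; case: (H z z01).
Unshelve. all: by end_near. Qed.

Lemma jacobiE (R : realType) (a b : R) (u v k : R -> R) :
  {within @unit_itv R, continuous v} -> {within @unit_itv R, continuous k} ->
  (forall s : R, 0 < s < 1 -> is_derive s 1 u (v s)) ->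
  (forall s : R, 0 < s < 1 -> is_derive s 1 v (k s)) ->
  forall s : R, 0 <= s <= 1 -> jacobi a b u s =
    - (s * (1 - s) * k s) - (a + 1 - (a + b + 2) * s) * v s.
Proof.
move=> cv ck uv vk s s01; rewrite /jacobi.
rewrite (cderive_unit_itv cv uv s01).
(* The outer [cderive] differentiates the extension [cderive _ 1 u] rather than v. The two agree on
   the unit interval, hence near each interior point, and so have the same derivative there. *)
suff -> : cderive (@unit_itv R) 1 (cderive (@unit_itv R) 1 u) s = k s by [].
apply: cderive_unit_itv => // r r01.
have : r \in `]0, 1[ by rewrite in_itv.
move=> /near_in_itvoo rn.
apply: near_eq_is_derive (vk r r01).
near=> z; apply/esym/(cderive_unit_itv cv uv).
suff : z \in `]0, 1[ by rewrite in_itv/= => /andP[? ?]; rewrite !ltW.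
by near: z.
Unshelve. all: by end_near. Qed.

Lemma Ck_continuous (R : realType) (k : nat) (D : set (R * R)) (f : R * R -> R) :
  Ck k D f -> {within D, continuous f}.
Proof. by case: k => [|k] []. Qed.

Lemma Ck_cderive1 (R : realType) (k : nat) (D : set (R * R)) (f : R * R -> R) :
  Ck k.+1 D f -> Ck k D (cderive D (1, 0) f).
Proof. by case=> _ /(_ (1, 0)) []//; left. Qed.

Lemma Ck_cderive2 (R : realType) (k : nat) (D : set (R * R)) (f : R * R -> R) :
  Ck k.+1 D f -> Ck k D (cderive D (0, 1) f).
Proof. by case=> _ /(_ (0, 1)) []//; right. Qed.

(** At an interior point, the convergence required by [Ck] is continuity of the partial derivatives,
    which is the hypothesis of [is_derive_dir]. *)
Lemma Ck_is_derive (R : realType) (k : nat) (D : set (R * R)) (f : R * R -> R)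
    (a b : R) (p : R * R) :
  Ck k.+1 D f -> D° p -> is_derive p (a, b) f
    (a * cderive D (1, 0) f p + b * cderive D (0, 1) f p).
Proof.
case=> _ H Dp.
have [d1 c1 _] := H (1, 0) (or_introl erefl).
have [d2 c2 _] := H (0, 1) (or_intror erefl).
have oD : open D° by exact: open_interior.
have cont v : (forall p, D p -> cvg ('D_v f z @[z --> within D° (nbhs p)])) ->
    {for p, continuous ('D_v f)}.
  move=> /(_ p (interior_subset Dp)) c; apply: cvg_continuous_at.
  by move: c; rewrite within_interior// (interior_id _).1.
rewrite (cderive_interior Dp (cont _ c1)) (cderive_interior Dp (cont _ c2)).
apply: is_derive_dir (cont _ c1) (cont _ c2).
apply: filterS (open_nbhs_nbhs (conj oD Dp)) => z Dz.
by split; [exact: d1|exact: d2].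
Qed.

(** * Pullback to the square *)

(** [Ds], [Dt], [Dss] and [Dtt] are what the chain rule predicts for the derivatives of f o Psi. As
    formulas in the extended partial derivatives of f they are continuous on the closed square from
    the start, and are shown to be derivatives afterwards. *)
Definition Ds (R : realType) (f : R * R -> R) (p : R * R) : R :=
  (2 - p.2) * dx f (Psi p).

Definition Dt (R : realType) (f : R * R -> R) (p : R * R) : R :=
  dy f (Psi p) - p.1 * dx f (Psi p).

Definition Dss (R : realType) (f : R * R -> R) (p : R * R) : R :=
  (2 - p.2) * Ds (dx f) p.

Definition Dtt (R : realType) (f : R * R -> R) (p : R * R) : R :=
  Dt (dy f) p - p.1 * Dt (dx f) p.

Lemma Psi_interior (R : realType) (s t : R) :
  0 < s < 1 -> 0 < t < 1 -> (@trapezoid R)° (Psi (s, t)).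
Proof.
move=> s01 t01; pose O : set (R * R) :=
  [set p | [/\ 0 < p.2, p.2 < 1, 0 < p.1 & p.1 < 2 - p.2]].
have oO : open O.
  have -> : O = ((snd @^-1` [set x | 0 < x] `&` snd @^-1` [set x | x < 1]) `&`
     (fst @^-1` [set x | 0 < x] `&` (fun p : R * R => p.1 + p.2) @^-1` [set x | x < 2])).
    apply/seteqP; split=> -[x y] /=.
      by rewrite /O/= => -[? ? ? ?]; do !split => //; lra.
    by rewrite /O/= => -[[? ?] [? ?]]; split=> //; lra.
  have c1 : continuous (@fst R R) by move=> p; exact: cvg_fst.
  have c2 : continuous (@snd R R) by move=> p; exact: cvg_snd.
  apply: openI; apply: openI.
  - by apply: open_comp => [? _|]; [exact: c2|exact: open_gt].
  - by apply: open_comp => [? _|]; [exact: c2|exact: open_lt].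
  - by apply: open_comp => [? _|]; [exact: c1|exact: open_gt].
  - apply: open_comp => [? _|]; last exact: open_lt.
    by apply: cvgD; [exact: c1|exact: c2].
apply: (@filterS _ _ _ O); last first.
  apply: open_nbhs_nbhs; split=> //.
  by case/andP: s01 => ? ?; case/andP: t01 => ? ?; split=> //=; nra.
by move=> [x y] [/= ? ? ? ?]; split=> /=; rewrite !ltW.
Qed.

Lemma continuous_Psi (R : realType) : continuous (@Psi R).
Proof.
have c1 : continuous (@fst R R) by move=> p; exact: cvg_fst.
have c2 : continuous (@snd R R) by move=> p; exact: cvg_snd.
move=> p; apply: (@cvg_pair _ _ _ _ (nbhs ((2 - p.2) * p.1)) (nbhs p.2)); last exact: c2.
by apply: cvgM; [apply: cvgB; [exact: cvg_cst|exact: c2]|exact: c1].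
Qed.

Lemma within_continuous_Psi (R : realType) (f : R * R -> R) :
  {within @trapezoid R, continuous f} ->
  {within @square R, continuous (f \o @Psi R)}.
Proof.
move=> cf; apply: within_continuous_comp cf _.
  by apply: continuous_subspaceT; exact: continuous_Psi.
by move=> p /Psi_trapezoid[].
Qed.

Lemma within_continuous_fst (R : realType) (A : set (R * R)) :
  {within A, continuous (fun p : R * R => p.1)}.
Proof. by apply: continuous_subspaceT => p; exact: cvg_fst. Qed.

Lemma within_continuous_snd (R : realType) (A : set (R * R)) :
  {within A, continuous (fun p : R * R => p.2)}.
Proof. by apply: continuous_subspaceT => p; exact: cvg_snd. Qed.

Lemma within_continuous_cst (R : realType) (A : set (R * R)) (c : R) :
  {within A, continuous (fun _ : R * R => c)}.
Proof. by apply: continuous_subspaceT => p; exact: cvg_cst. Qed.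

Section pullback.
Variables (R : realType) (k : nat) (f : R * R -> R).
Hypothesis Cf : Ck k.+1 (@trapezoid R) f.

Lemma Ds_continuous : {within @square R, continuous (Ds f)}.
Proof.
apply: within_continuousM; last first.
  exact/within_continuous_Psi/Ck_continuous/Ck_cderive1/Cf.
by apply: within_continuousB; [exact: within_continuous_cst|exact: within_continuous_snd].
Qed.

Lemma Dt_continuous : {within @square R, continuous (Dt f)}.
Proof.
apply: within_continuousB.
  exact/within_continuous_Psi/Ck_continuous/Ck_cderive2/Cf.
apply: within_continuousM; first exact: within_continuous_fst.
exact/within_continuous_Psi/Ck_continuous/Ck_cderive1/Cf.
Qed.

Lemma is_derive_Ds (s t : R) : 0 < s < 1 -> 0 <= t <= 1 ->
  is_derive s 1 (fun z => f (Psi (z, t))) (Ds f (s, t)).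
Proof.
move: s t; apply: (is_derive_square_fst (u := f \o @Psi R)).
- exact/within_continuous_Psi/Ck_continuous/Cf.
- exact: Ds_continuous.
move=> s t s01 t01.
have E (z : R) : Psi (z, t) = z *: (2 - t, 0) + (0, t) :> R * R.
  by congr pair; rewrite /= /GRing.scale/=; ring.
under eq_fun do rewrite /= E.
apply/is_derive_line; rewrite -E.
have -> : Ds f (s, t) = (2 - t) * dx f (Psi (s, t)) + 0 * dy f (Psi (s, t)).
  by rewrite mul0r addr0.
by apply: Ck_is_derive Cf _; exact: Psi_interior.
Qed.

Lemma is_derive_Dt (s t : R) : 0 <= s <= 1 -> 0 < t < 1 ->
  is_derive t 1 (fun z => f (Psi (s, z))) (Dt f (s, t)).
Proof.
move: s t; apply: (is_derive_square_snd (u := f \o @Psi R)).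
- exact/within_continuous_Psi/Ck_continuous/Cf.
- exact: Dt_continuous.
move=> s t s01 t01.
(* A vertical segment of the square becomes the slanted segment that starts at (2 s, 0); the
   direction (-s, 1) is the source of the term -s dx f in [Dt]. *)
have E (z : R) : Psi (s, z) = z *: (- s, 1) + (2 * s, 0) :> R * R.
  by congr pair; rewrite /= /GRing.scale/=; ring.
under eq_fun do rewrite /= E.
apply/is_derive_line; rewrite -E.
have -> : Dt f (s, t) = - s * dx f (Psi (s, t)) + 1 * dy f (Psi (s, t)).
  by rewrite /Dt mul1r mulNr addrC.
by apply: Ck_is_derive Cf _; exact: Psi_interior.
Qed.

End pullback.

Section pullback2.
Variables (R : realType) (f : R * R -> R).
Hypothesis Cf : Ck 2 (@trapezoid R) f.

Lemma Dss_continuous : {within @square R, continuous (Dss f)}.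
Proof.
apply: within_continuousM; last exact/Ds_continuous/Ck_cderive1/Cf.
by apply: within_continuousB; [exact: within_continuous_cst|exact: within_continuous_snd].
Qed.

Lemma Dtt_continuous : {within @square R, continuous (Dtt f)}.
Proof.
apply: within_continuousB; first exact/Dt_continuous/Ck_cderive2/Cf.
apply: within_continuousM; first exact: within_continuous_fst.
exact/Dt_continuous/Ck_cderive1/Cf.
Qed.

Lemma is_derive_Dss (s t : R) : 0 < s < 1 -> 0 <= t <= 1 ->
  is_derive s 1 (fun z => Ds f (z, t)) (Dss f (s, t)).
Proof.
move=> s01 t01; rewrite /Ds /=.
have D := is_derive_Ds (Ck_cderive1 Cf) s01 t01.
exact: (is_deriveZ (2 - t) D).
Qed.

Lemma is_derive_Dtt (s t : R) : 0 <= s <= 1 -> 0 < t < 1 ->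
  is_derive t 1 (fun z => Dt f (s, z)) (Dtt f (s, t)).
Proof.
move=> s01 t01.
have D1 := is_derive_Dt (Ck_cderive1 Cf) s01 t01.
have D2 := is_derive_Dt (Ck_cderive2 Cf) s01 t01.
exact: (is_deriveB D2 (is_deriveZ s D1)).
Qed.

Lemma LQ_Psi (al be ga de : R) (p : R * R) : square p ->
  LQ al be ga de (f \o @Psi R) p =
    (- (p.1 * (1 - p.1) * Dss f p) - (ga + 1 - (ga + de + 2) * p.1) * Ds f p) +
    (- (p.2 * (1 - p.2) * Dtt f p) - (al + 1 - (al + be + 2) * p.2) * Dt f p).
Proof.
case: p => s t [/= s01 t01]; rewrite /LQ/=; congr (_ + _).
- apply: (@jacobiE _ _ _ _ (fun z => Ds f (z, t)) (fun z => Dss f (z, t))) => //.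
  + exact: (within_square_fst t01 (Ds_continuous Cf)).
  + exact: (within_square_fst t01 Dss_continuous).
  + by move=> z z01; exact: (is_derive_Ds Cf).
  + by move=> z z01; exact: is_derive_Dss.
- apply: (@jacobiE _ _ _ _ (fun z => Dt f (s, z)) (fun z => Dtt f (s, z))) => //.
  + exact: (within_square_snd s01 (Dt_continuous Cf)).
  + exact: (within_square_snd s01 Dtt_continuous).
  + by move=> z z01; exact: (is_derive_Dt Cf).
  + by move=> z z01; exact: is_derive_Dtt.
Qed.

End pullback2.

(** * Measurability of continuous functions of two variables *)

(** The product sigma-algebra is generated by rectangles, so an open set is written as a countable
    union of boxes with rational centres and radii 1 / (n + 1). Boxes not contained in O are
    replaced by the empty set. *)
Lemma open_measurable_prod (R : realType) (O : set (R * R)) :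
  open O -> measurable O.
Proof.
move=> oO.
pose B (q : rat * rat * nat) : set (R * R) :=
  ball (ratr q.1.1 : R) q.2.+1%:R^-1 `*` ball (ratr q.1.2 : R) q.2.+1%:R^-1.
pose F q := if pselect (B q `<=` O) then B q else set0.
have -> : O = \bigcup_q F q.
  apply/seteqP; split=> [[x y] Oxy|p [q _]]; last first.
    by rewrite /F; case: pselect => // BO; exact: BO.
  have /nbhs_ballP[e /= e0 eO] : nbhs (x, y) O by exact: open_nbhs_nbhs.
  (* Two points in a ball of radius 1 / (n + 1) are less than 2 / (n + 1) apart, so a box of that
     radius around a rational centre that contains (x, y) lies in the e-ball. *)
  have [n ne] : exists n, 2 * n.+1%:R^-1 < e.
    have [n _ /(_ n (leqnn n))] := near_infty_natSinv_lt (PosNum (divr_gt0 e0 (ltr0n R 2))).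
    by move=> /= h; exists n; rewrite mulrC -ltr_pdivlMr.
  have n0 : 0 < n.+1%:R^-1 :> R by rewrite invr_gt0.
  have nr (z : R) : exists q : rat, ball (ratr q : R) n.+1%:R^-1 z.
    have zz : z - n.+1%:R^-1 < z + n.+1%:R^-1.
      by rewrite ltrBlDr -addrA ltrDl addr_gt0.
    have [q] := rat_in_itvoo zz.
    rewrite in_itv/= => /andP[q1 q2]; exists q; rewrite /ball/= ltr_norml.
    by move: q1 q2; set k := n.+1%:R^-1 => q1 q2; lra.
  have [q1 q1x] := nr x; have [q2 q2y] := nr y.
  exists (q1, q2, n) => //; rewrite /F; case: pselect => // -[].
  move=> [x' y'] [/= h1 h2]; apply: eO.
  have tri (q z z' : R) : ball q n.+1%:R^-1 z -> ball q n.+1%:R^-1 z' -> ball z e z'.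
    rewrite /ball/= !ltr_norml; set k := n.+1%:R^-1 in ne *.
    by move=> /andP[? ?] /andP[? ?]; lra.
  by split; [apply: tri q1x h1|apply: tri q2y h2].
apply: countable_bigcupT_measurable => // q; rewrite /F; case: pselect => [H|H] //=.
by apply: measurableX; exact: measurable_ball.
Qed.

Lemma within_continuous_measurable (R : realType) (D : set (R * R)) (f : R * R -> R) :
  measurable D -> {within D, continuous f} -> measurable_fun D f.
Proof.
move=> mD /continuousP cf; apply: (measurability _ (RGenOpens.measurableE R)).
move=> _ [_ [a [b ->] <-]].
have := cf _ (@interval_open _ (BRight a) (BLeft b) erefl erefl).
move=> /open_subspaceP[V oV].
move=> VE; have -> : D `&` f @^-1` `]a, b[ = V `&` D by rewrite VE setIC.
by apply: measurableI => //; exact: open_measurable_prod.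
Qed.

(** * Jacobi weights and integration by parts on the unit interval *)

(* Only the negative part of f is assumed to have a finite integral, so that the
   lemma also yields the integrability of a nonnegative f. *)
Lemma FTC_oo (R : realType) (f F : R -> R) :
  {in `]0, 1[, continuous f} ->
  (forall x : R, 0 < x < 1 -> is_derive x 1 F (f x)) ->
  {within `[0, 1], continuous F} ->
  (\int[@lebesgue_measure R]_(x in `]0%R, 1%R[) (EFin \o f)^\- x)%E \is a fin_num ->
  (\int[@lebesgue_measure R]_(x in `]0%R, 1%R[) (f x)%:E)%E = (F 1 - F 0)%:E.
Proof.
move=> cf dF /(continuous_within_itvP _ ltr01)[_ F0 F1] fm.
(* The offset 3 gives e n < 1/2 for every n, so each [e n, 1 - e n] is a nondegenerate interval. The
   archimedean bound for 1 / (m + 1) is accordingly used at m = n + 2. *)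
pose e n : R := n.+3%:R^-1.
have e0 n : 0 < e n by rewrite invr_gt0.
have e3 n : e n < 2^-1 by rewrite ltf_pV2 ?posrE// ltr_nat.
pose I n : set R := `[e n, 1 - e n]%classic.
have en_mono : {homo e : n m / (n <= m)%N >-> m <= n}.
  by move=> n m nm; rewrite lef_pV2 ?posrE// ler_nat.
have ndI : {homo I : n m / (n <= m)%N >-> (n <= m)%O}.
  move=> n m /en_mono nm; apply/subsetPset => x; rewrite /I/= !in_itv/=.
  by move=> /andP[? ?]; lra.
have IE : \bigcup_n I n = `]0, 1[%classic.
  apply/seteqP; split=> [x [n _]|x].
    by rewrite /I/= !in_itv/=; have := e0 n; lra.
  rewrite /= in_itv/= => /andP[x0 x1].
  have m0 : 0 < Num.min x (1 - x) by rewrite lt_min x0 subr_gt0.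
  have [n _ /(_ n.+2)] := near_infty_natSinv_lt (PosNum m0).
  rewrite /= lt_min => /(_ (leq_trans (leqnSn _) (leqnSn _)))/andP[].
  rewrite -/(e n) => h1 h2.
  by exists n => //; rewrite /I/= in_itv/=; lra.
have mI n : measurable (I n) by exact: measurable_itv.
have II n : I n `<=` `]0, 1[ by rewrite -IE; exact: bigcup_sup.
have mf : measurable_fun (`]0, 1[%classic : set R) (EFin \o f).
  apply/measurable_EFinP; apply: open_continuous_measurable_fun.
    exact: interval_open.
  by move=> x; rewrite inE => /cf.
have mfI n : measurable_fun (I n) (EFin \o f).
  by apply: measurable_funS (@II n) mf.
have eI n : (\int[@lebesgue_measure R]_(x in I n) (f x)%:E = (F (1 - e n))%:E - (F (e n))%:E)%E.
  have lt : e n < 1 - e n by have := e3 n; lra.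
  have in01 x : x \in `[e n, 1 - e n] -> x \in `]0, 1[.
    by rewrite !in_itv/=; have := e0 n; lra.
  have dF' x : x \in `[e n, 1 - e n] -> derivable F x 1.
    by move=> /in01; rewrite in_itv => /dF[].
  apply: continuous_FTC2 => //.
  - by apply: continuous_in_subspaceT => x; rewrite inE => /in01/cf.
  - have := derivable_within_continuous dF'.
    move=> /(continuous_within_itvP _ lt)[_ ? ?]; split=> // x.
    by move=> /subset_itv_oo_cc/dF'.
  - move=> x /subset_itv_oo_cc/in01; rewrite in_itv derive1E => /dF dFx.
    exact: derive_val.
have Cp : ((\int[@lebesgue_measure R]_(x in I n) (EFin \o f)^\+ x)%E @[n --> \oo] -->
    \int[@lebesgue_measure R]_(x in \bigcup_n I n) (EFin \o f)^\+ x)%E.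
  apply: ge0_nondecreasing_set_cvg_integral => //.
  by move=> n; exact: measurable_funepos (mfI n).
have Cm : ((\int[@lebesgue_measure R]_(x in I n) (EFin \o f)^\- x)%E @[n --> \oo] -->
    \int[@lebesgue_measure R]_(x in \bigcup_n I n) (EFin \o f)^\- x)%E.
  apply: ge0_nondecreasing_set_cvg_integral => //.
  by move=> n; exact: measurable_funeneg (mfI n).
rewrite IE in Cp Cm.
(* Positive and negative parts converge monotonically and separately; the finite negative part [fm]
   excludes an indeterminate difference of infinities. *)
have C1 : ((\int[@lebesgue_measure R]_(x in I n) (f x)%:E)%E @[n --> \oo] -->
   \int[@lebesgue_measure R]_(x in `]0%R, 1%R[) (f x)%:E)%E.
  rewrite integralE.
  under eq_cvg do rewrite integralE.
  apply: cvgeB => //.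
  by apply: fin_num_adde_defl; rewrite fin_numN.
have ecvg : e n @[n --> \oo] --> 0.
  apply/cvgrPdist_lt => d d0.
  have [n _ nd] := near_infty_natSinv_lt (PosNum d0).
  exists n => // m nm; rewrite /= sub0r normrN gtr0_norm//.
  apply: (nd m.+2); exact: leq_trans nm (leq_trans (leqnSn _) (leqnSn _)).
have C2 : (((F (1 - e n))%:E - (F (e n))%:E)%E @[n --> \oo] --> (F 1 - F 0)%:E)%E.
  rewrite EFinB; apply: cvgeB => //; (apply: cvg_EFin; first exact: nearW).
    move/cvg_at_leftP : F1; apply; split=> [n|]; first by have := e0 n; lra.
    by rewrite -[X in _ --> X]subr0; apply: cvgB ecvg; exact: cvg_cst.
  by move/cvg_at_rightP : F0; apply; split.
move: C1; under eq_cvg do rewrite eI. move=> C1.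
exact: (cvg_unique _ C1 C2).
Qed.

Lemma within_continuous_powR (R : realType) (c : R) :
  0 < c -> {within `[0, +oo[, continuous (fun x : R => x `^ c)}.
Proof.
move=> c0; apply/continuous_within_itvcyP; split=> [x|].
  rewrite in_itv/= andbT => x0.
  have [/derivable1_diffP/differentiable_continuous + _] := is_derive1_powR c x0.
  exact.
by rewrite powR0 ?gt_eqF//; exact: powR_cvg0.
Qed.

Lemma measurable_w (R : realType) (a b : R) (D : set R) : measurable_fun D (w a b).
Proof.
apply: (@measurable_funS _ _ _ _ setT) => //.
apply: measurable_funM; first exact: measurable_powR.
apply: (measurableT_comp (measurable_powR b)).
exact: measurable_funB.
Qed.

Lemma w_ge0 (R : realType) (a b r : R) : 0 <= w a b r.
Proof. by rewrite mulr_ge0// powR_ge0. Qed.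

Lemma within_powR01 (R : realType) (c : R) : 0 < c ->
  {within `[0, 1], continuous (fun x : R => x `^ c)}.
Proof.
move=> c0; apply: continuous_subspaceW (within_continuous_powR c0).
by move=> x; rewrite /= !in_itv/= andbT => /andP[].
Qed.

Lemma within_powR10 (R : realType) (c : R) : 0 < c ->
  {within `[0, 1], continuous (fun x : R => (1 - x) `^ c)}.
Proof.
move=> c0; have c1 : {within `[0, 1], continuous (fun x : R => 1 - x)}.
  apply: continuous_subspaceT => x.
  by apply: cvgB; [exact: cvg_cst|exact: cvg_id].
apply: (within_continuous_comp c1 (within_powR01 c0)).
by move=> x; rewrite /= !in_itv/=; lra.
Qed.

Lemma within_wS (R : realType) (a b : R) : -1 < a -> -1 < b ->
  {within `[0, 1], continuous (w (a + 1) (b + 1))}.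
Proof.
by move=> a1 b1; apply: within_continuousM;
  [apply: within_powR01|apply: within_powR10]; lra.
Qed.

Lemma powRS (R : realType) (x c : R) : 0 < x -> x `^ (c + 1) = x `^ c * x.
Proof.
by move=> x0; rewrite powRD ?powRr1 ?(ltW x0)// (gt_eqF x0) implybT.
Qed.

Lemma wS (R : realType) (a b r : R) : 0 < r < 1 ->
  w (a + 1) (b + 1) r = w a b r * (r * (1 - r)).
Proof.
by move=> /andP[r0 r1]; rewrite /w !powRS ?subr_gt0// mulrACA.
Qed.

Lemma is_derive_powR10 (R : realType) (c r : R) : r < 1 ->
  is_derive r 1 (fun x : R => (1 - x) `^ c) (- (c * (1 - r) `^ (c - 1))).
Proof.
rewrite -subr_gt0 => r1.
have D1 : is_derive r 1 (fun s : R => 1 - s) (- 1).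
  have := is_deriveB (is_derive_cst (1 : R) r 1) (is_derive_id r 1).
  by rewrite sub0r.
have := @is_derive1_comp R (fun s => s `^ c) (fun s => 1 - s) r _ _
    (is_derive1_powR c r1) D1.
by rewrite mulrN1.
Qed.

(* w (a + 1) (b + 1) is the coefficient w a b r * r (1 - r) of the divergence form
   of the Jacobi expression, extended continuously by 0 to the endpoints. *)
Lemma is_derive_wS (R : realType) (a b r : R) : 0 < r < 1 ->
  is_derive r 1 (w (a + 1) (b + 1)) (w a b r * (a + 1 - (a + b + 2) * r)).
Proof.
move=> /andP[r0 r1]; have r1' : 0 < 1 - r by lra.
have Da := is_derive1_powR (a + 1) r0.
have Db := is_derive_powR10 (b + 1) r1.
apply: is_derive_eq (is_deriveM Da Db) _.
rewrite /w /GRing.scale/= !addrK.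
rewrite !powRS//; ring.
Qed.

Lemma w_continuous (R : realType) (a b : R) : {in `]0, 1[, continuous (w a b)}.
Proof.
move=> r; rewrite in_itv/= => r01.
(* With both exponents lowered by one, the flux coefficient is [w a b] itself, which is thus
   differentiable inside the interval. *)
have := is_derive_wS (a - 1) (b - 1) r01; rewrite !subrK => -[].
by move=> /derivable1_diffP/differentiable_continuous.
Qed.

Lemma w_le (R : realType) (a b r : R) : 0 < r < 1 ->
  w a b r <= (1 + 2^-1 `^ b) * r `^ a + (1 + 2^-1 `^ a) * (1 - r) `^ b.
Proof.
have P (c x : R) : 2^-1 <= x -> x <= 1 -> x `^ c <= 1 + 2^-1 `^ c.
  move=> x0 x1; have [c0|c0] := leP 0 c.
    apply: (@le_trans _ _ 1); last by rewrite lerDl powR_ge0.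
    have one : 1 `^ c = 1 :> R by rewrite powR1.
    by rewrite -[leRHS]one ge0_ler_powR// ?nnegrE//; lra.
  apply: (@le_trans _ _ (2^-1 `^ c)); last by rewrite lerDr.
  rewrite -(opprK c) powRN [leRHS]powRN lef_pV2 ?posrE ?powR_gt0//; [|lra].
  by rewrite ge0_ler_powR ?nnegrE//; lra.
move=> /andP[r0 r1]; have A := powR_ge0 r a; have B := powR_ge0 (1 - r) b.
have A' := powR_ge0 2^-1 a; have B' := powR_ge0 2^-1 b; rewrite /w.
have [h|h] := leP r 2^-1.
- have : (1 - r) `^ b <= 1 + 2^-1 `^ b by apply: P; lra.
  nra.
- have : r `^ a <= 1 + 2^-1 `^ a by apply: P; lra.
  nra.
Qed.

Lemma integrable_w (R : realType) (a b : R) : -1 < a -> -1 < b ->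
  (@lebesgue_measure R).-integrable `[0%R, 1%R] (EFin \o w a b).
Proof.
move=> a1 b1.
pose ca := 1 + 2^-1 `^ a; pose cb := 1 + 2^-1 `^ b.
pose f r := cb * r `^ a + ca * (1 - r) `^ b.
(* A primitive of the majorant of [w_le]. Its exponents are positive because -1 < a and -1 < b,
   hence it is continuous on the closed interval; [f] has no negative part, so [FTC_oo] gives its
   integral a finite value. *)
pose F r := cb / (a + 1) * r `^ (a + 1) - ca / (b + 1) * (1 - r) `^ (b + 1).
have ca0 : 0 <= ca by rewrite addr_ge0// powR_ge0.
have cb0 : 0 <= cb by rewrite addr_ge0// powR_ge0.
have f0 r : 0 <= f r by rewrite addr_ge0// mulr_ge0// powR_ge0.
have cc (c : R) : {within `[0, 1], continuous (fun _ : R => c)}.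
  by apply: continuous_subspaceT => x; exact: cvg_cst.
have cF : {within `[0, 1], continuous F}.
  apply: within_continuousB; apply: within_continuousM => //.
    by apply: within_powR01; lra.
  by apply: within_powR10; lra.
have dF (r : R) : 0 < r < 1 -> is_derive r 1 F (f r).
  move=> /andP[r0 r1].
  have Da := is_derive1_powR (a + 1) r0.
  have Db := is_derive_powR10 (b + 1) r1.
  apply: is_derive_eq (is_deriveB (is_deriveZ (cb / (a + 1)) Da)
    (is_deriveZ (ca / (b + 1)) Db)) _.
  by rewrite /f /GRing.scale/= !addrK; field; lra.
have cf : {in `]0, 1[, continuous f}.
  move=> r; rewrite in_itv/= => /andP[r0 r1].
  apply: cvgD; apply: cvgM; [exact: cvg_cst| |exact: cvg_cst|].
    by case: (is_derive1_powR a r0) => /derivable1_diffP/differentiable_continuous.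
  by case: (is_derive_powR10 b r1) => /derivable1_diffP/differentiable_continuous.
have nf : ((EFin \o f)^\- = cst 0)%E.
  by apply/funext => x; rewrite funenegE/= max_r// lee_fin oppr_le0.
have If := FTC_oo cf dF cF.
apply/integrableP; split; first by apply/measurable_EFinP; exact: (@measurable_w R a b _).
rewrite integral_itv_bndoo; last first.
  apply: measurableT_comp => //; apply/measurable_EFinP; exact: (@measurable_w R a b _).
apply: (@le_lt_trans _ _ (\int[lebesgue_measure]_(x in `]0%R, 1%R[) (f x)%:E)%E).
  apply: ge0_le_integral => //=.
  - apply/measurable_EFinP; apply: measurableT_comp => //; exact: (@measurable_w R a b _).
  - apply/measurable_EFinP; apply: open_continuous_measurable_fun.
      exact: interval_open.
    by move=> x; rewrite inE => /cf.
  - by move=> x; rewrite in_itv/= lee_fin ger0_norm ?w_ge0// => /w_le.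
by rewrite If ?ltry// nf integral0.
Qed.

Lemma within_compact_bounded (R : realType) (X : topologicalType) (A : set X)
    (f : X -> R) : compact A -> {within A, continuous f} ->
  exists M, forall x, A x -> `|f x| <= M.
Proof.
move=> cA cf; have /compact_bounded[M [_ HM]] := continuous_compact cf cA.
exists (M + 1) => x Ax; apply: (HM (M + 1)); first by rewrite ltrDl.
by exists x.
Qed.

Lemma integrable_bounded_mul d (T : measurableType d) (R : realType)
    (mu : {measure set T -> \bar R}) (D : set T) (c W : T -> R) (M : R) :
  measurable D -> measurable_fun D c -> (forall x, D x -> `|c x| <= M) ->
  mu.-integrable D (EFin \o W) ->
  mu.-integrable D (EFin \o (fun x => c x * W x)).
Proof.
move=> mD mc cM iW.
have mW : measurable_fun D W by apply/measurable_EFinP; exact: measurable_int iW.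
apply: (@le_integrable _ _ _ mu D mD _ (fun x => M%:E * (W x)%:E)%E).
- by apply/measurable_EFinP; exact: measurable_funM.
- move=> x Dx /=; rewrite lee_fin !normrM ler_wpM2r//.
  by apply: le_trans (cM _ Dx) _; exact: ler_norm.
- exact: integrableZl.
Qed.

Lemma integrable_within_w (R : realType) (a b : R) (c : R -> R) :
  -1 < a -> -1 < b -> {within @unit_itv R, continuous c} ->
  (@lebesgue_measure R).-integrable (@unit_itv R) (EFin \o (fun r => c r * w a b r)).
Proof.
move=> a1 b1 cc.
have [M cM] := within_compact_bounded (@segment_compact R 0 1) cc.
have mI : measurable (@unit_itv R) by exact: measurable_itv.
apply: (@integrable_bounded_mul _ _ R (@lebesgue_measure R) (@unit_itv R) c (w a b) M) => //.
  exact: (subspace_continuous_measurable_fun mI cc).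
exact: integrable_w.
Qed.

Lemma within_itvoo (R : realType) (f : R -> R) :
  {within @unit_itv R, continuous f} -> {in `]0, 1[, continuous f}.
Proof.
move=> /subspace_continuousP cf x x01.
have Ix : @unit_itv R x by exact: subset_itv_oo_cc.
by have := cf x Ix; rewrite within_interior// /unit_itv interior_itv.
Qed.

Lemma jacobi_parts (R : realType) (a b : R) (u1 u2 v v1 : R -> R) :
  -1 < a -> -1 < b ->
  {within @unit_itv R, continuous u1} -> {within @unit_itv R, continuous u2} ->
  {within @unit_itv R, continuous v} -> {within @unit_itv R, continuous v1} ->
  (forall s : R, 0 < s < 1 -> is_derive s 1 u1 (u2 s)) ->
  (forall s : R, 0 < s < 1 -> is_derive s 1 v (v1 s)) ->
  (\int[@lebesgue_measure R]_(s in @unit_itv R)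
     ((- (s * (1 - s) * u2 s) - (a + 1 - (a + b + 2) * s) * u1 s) * v s * w a b s)%:E =
   \int[@lebesgue_measure R]_(s in @unit_itv R)
     (s * (1 - s) * u1 s * v1 s * w a b s)%:E)%E.
Proof.
move=> a1 b1 cu1 cu2 cv cv1 du dv.
have cid : {within @unit_itv R, continuous (fun x : R => x)}.
  by apply: continuous_subspaceT => x; exact: cvg_id.
have cc (c : R) : {within @unit_itv R, continuous (fun _ : R => c)}.
  by apply: continuous_subspaceT => x; exact: cvg_cst.
set j := fun s => - (s * (1 - s) * u2 s) - (a + 1 - (a + b + 2) * s) * u1 s.
have cj : {within @unit_itv R, continuous j}.
  apply: within_continuousB.
    apply/within_continuousN/within_continuousM => //.
    by apply: within_continuousM => //; apply: within_continuousB.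
  apply: within_continuousM => //.
  by apply: within_continuousB => //; apply: within_continuousM.
have cjv : {within @unit_itv R, continuous (fun s => j s * v s)} by exact: within_continuousM.
have ce : {within @unit_itv R, continuous (fun s => s * (1 - s) * u1 s * v1 s)}.
  do 2! apply: within_continuousM => //.
  by apply: within_continuousM => //; apply: within_continuousB.
have I1 := integrable_within_w a1 b1 cjv.
have I2 := integrable_within_w a1 b1 ce.
pose F s := w (a + 1) (b + 1) s * (u1 s * v s).
(* By the product rule this is the derivative of the flux [F]: the energy density minus the Jacobi
   term. *)
pose f s := s * (1 - s) * u1 s * v1 s * w a b s - j s * v s * w a b s.
have cF : {within `[0, 1], continuous F}.
  by apply: within_continuousM; [exact: within_wS|exact: within_continuousM].
have dF (s : R) : 0 < s < 1 -> is_derive s 1 F (f s).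
  move=> s01.
  apply: is_derive_eq (is_deriveM (is_derive_wS a b s01) (is_deriveM (du _ s01) (dv _ s01))) _.
  rewrite wS//.
  by rewrite /f /j /GRing.scale/= fctE; ring.
have cf : {in `]0, 1[, continuous f}.
  move=> s s01; have cw : {for s, continuous (w a b)} by exact: w_continuous.
  apply: cvgB; apply: cvgM => //.
    exact: (within_itvoo ce s01).
  exact: (within_itvoo cjv s01).
have mI : measurable (@unit_itv R) by exact: measurable_itv.
have EB : (EFin \o f = (EFin \o (fun r => (r * (1 - r) * u1 r * v1 r * w a b r)%R))
     \- (EFin \o (fun r => (j r * v r * w a b r)%R)))%E.
  by apply/funext => x; rewrite /= EFinB.
have If : (@lebesgue_measure R).-integrable (@unit_itv R) (EFin \o f).
  by rewrite EB; exact: (integrableB (mu := lebesgue_measure) mI I2 I1).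
have If' : (@lebesgue_measure R).-integrable `]0%R, 1%R[ (EFin \o f).
  by apply: integrableS If => //; exact: subset_itv_oo_cc.
have F0 : F 0 = 0 by rewrite /F /w powR0 ?mul0r//; lra.
have F1 : F 1 = 0 by rewrite /F /w subrr (powR0 (x := b + 1)) ?mulr0 ?mul0r//; lra.
have mf : measurable_fun (`]0, 1[%classic : set R) (EFin \o f) by exact: measurable_int If'.
have If0 : (\int[@lebesgue_measure R]_(x in @unit_itv R) (EFin \o f) x = 0)%E.
  rewrite (integral_itv_bndoo _ _ mf) (FTC_oo cf dF cF) ?F0 ?F1 ?subrr//.
  by apply: integrable_fin_num => //; exact: integrable_funeneg.
(* Each of the two integrals is finite by [I1] and [I2], so the vanishing of their difference can be
   cancelled in the extended reals. *)
rewrite EB (integralB (mu := lebesgue_measure) mI I2 I1) in If0.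
have fB := integrable_fin_num (mu := lebesgue_measure) mI I1.
by rewrite -[RHS](subeK _ fB) If0 add0e.
Qed.

(** * Fubini on rectangles *)

Section fubini_rectangle.
Context d1 d2 (T1 : measurableType d1) (T2 : measurableType d2) (R : realType).
Variables (m1 : {sigma_finite_measure set T1 -> \bar R}).
Variables (m2 : {sigma_finite_measure set T2 -> \bar R}).
Variables (D1 : set T1) (D2 : set T2).
Hypotheses (mD1 : measurable D1) (mD2 : measurable D2).
Local Open Scope ereal_scope.

Lemma restrict_fst (F : T1 * T2 -> \bar R) (y : T2) :
  \int[m1]_x (F \_ (D1 `*` D2)) (x, y) =
  if y \in D2 then \int[m1]_(x in D1) F (x, y) else 0.
Proof.
case: ifPn => [yD|yD].
  rewrite [RHS]integral_mkcond; apply: eq_integral => x _.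
  by rewrite !patchE in_setX yD andbT.
by apply: integral0_eq => x _; rewrite patchE in_setX (negbTE yD) andbF.
Qed.

Lemma restrict_snd (F : T1 * T2 -> \bar R) (x : T1) :
  \int[m2]_y (F \_ (D1 `*` D2)) (x, y) =
  if x \in D1 then \int[m2]_(y in D2) F (x, y) else 0.
Proof.
case: ifPn => [xD|xD].
  rewrite [RHS]integral_mkcond; apply: eq_integral => y _.
  by rewrite !patchE in_setX xD.
by apply: integral0_eq => y _; rewrite patchE in_setX (negbTE xD).
Qed.

(** Integration by parts equates integrals over each row, not integrands; Fubini, applied to the
    extensions by zero, lifts this to the double integrals. *)
Lemma eq_integral_rectangle_fst (F G : T1 * T2 -> \bar R) :
  (m1 \x m2).-integrable (D1 `*` D2) F -> (m1 \x m2).-integrable (D1 `*` D2) G ->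
  (forall y, D2 y -> \int[m1]_(x in D1) F (x, y) = \int[m1]_(x in D1) G (x, y)) ->
  \int[m1 \x m2]_(z in D1 `*` D2) F z = \int[m1 \x m2]_(z in D1 `*` D2) G z.
Proof.
have mD : measurable (D1 `*` D2) by exact: measurableX.
move=> /(integrable_mkcond _ mD) iF /(integrable_mkcond _ mD) iG FG.
rewrite integral_mkcond [RHS]integral_mkcond.
rewrite -(integral21_prod_meas1 iF) -(integral21_prod_meas1 iG); apply: eq_integral => y _.
rewrite /fubini_G !restrict_fst; case: ifPn => // /[!inE]; exact: FG.
Qed.

Lemma eq_integral_rectangle_snd (F G : T1 * T2 -> \bar R) :
  (m1 \x m2).-integrable (D1 `*` D2) F -> (m1 \x m2).-integrable (D1 `*` D2) G ->
  (forall x, D1 x -> \int[m2]_(y in D2) F (x, y) = \int[m2]_(y in D2) G (x, y)) ->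
  \int[m1 \x m2]_(z in D1 `*` D2) F z = \int[m1 \x m2]_(z in D1 `*` D2) G z.
Proof.
have mD : measurable (D1 `*` D2) by exact: measurableX.
move=> /(integrable_mkcond _ mD) iF /(integrable_mkcond _ mD) iG FG.
rewrite integral_mkcond [RHS]integral_mkcond.
rewrite -(integral12_prod_meas1 iF) -(integral12_prod_meas1 iG); apply: eq_integral => x _.
rewrite /fubini_F !restrict_snd; case: ifPn => // /[!inE]; exact: FG.
Qed.

(** By Tonelli it suffices that the iterated integral of the absolute value is finite, and for a
    nonnegative product it factors into the two given integrals. *)
Lemma integrable_rectangle (f : T1 -> R) (g : T2 -> R) :
  (forall x, 0 <= f x)%R -> (forall y, 0 <= g y)%R ->
  m1.-integrable D1 (EFin \o f) -> m2.-integrable D2 (EFin \o g) ->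
  (m1 \x m2).-integrable (D1 `*` D2) (fun z => (f z.1 * g z.2)%:E).
Proof.
move=> f0 g0 i_f i_g.
have mD : measurable (D1 `*` D2) by exact: measurableX.
have mf : measurable_fun D1 f by apply/measurable_EFinP; exact: measurable_int i_f.
have mg : measurable_fun D2 g by apply/measurable_EFinP; exact: measurable_int i_g.
have mF : measurable_fun (D1 `*` D2) (fun z => (f z.1 * g z.2)%:E).
  apply/measurable_EFinP/measurable_funM.
    apply: (measurable_comp mD1 _ mf) => //; first by move=> _ [z [+ _] <-].
    exact: measurable_funS measurable_fst.
  apply: (measurable_comp mD2 _ mg) => //; first by move=> _ [z [_ +] <-].
  exact: measurable_funS measurable_snd.
apply/(integrable_mkcond _ mD)/integrable21ltyP.
  by apply/(measurable_restrictT _ mD).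
pose c := \int[m1]_(x in D1) (f x)%:E.
have cE : c \is a fin_num by exact: integrable_fin_num i_f.
rewrite (_ : \int[m2]_y _ = c * \int[m2]_(y in D2) (g y)%:E).
  apply: lte_mul_pinfty => //; first by apply: integral_ge0 => x _; rewrite lee_fin.
  by rewrite -ge0_fin_numE ?(integrable_fin_num _ i_g)// integral_ge0// => y _; rewrite lee_fin.
rewrite -ge0_integralZl//; last first.
- by apply: integral_ge0 => x _; rewrite lee_fin.
- by move=> y _; rewrite lee_fin.
- exact/measurable_EFinP.
rewrite [RHS]integral_mkcond; apply: eq_integral => y _.
under eq_integral => x _.
  rewrite gee0_abs; last by rewrite patchE; case: ifPn => // _; rewrite lee_fin mulr_ge0.
  over.
rewrite restrict_fst patchE; case: ifPn => // yD.
under eq_integral do rewrite /= EFinM.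
rewrite ge0_integralZr//.
- exact/measurable_EFinP.
- by move=> x _; rewrite lee_fin.
- by rewrite lee_fin.
Qed.
End fubini_rectangle.

(** * Change of variables *)

(** Lebesgue measure is c times its own image under x -> c x / c^0 scaling by c in reverse: the set
    function c |{x : c x in A}| agrees with |A| on half-open intervals, and uniqueness of Lebesgue
    measure extends this to all measurable A. *)
Lemma ge0_integral_scale (R : realType) (c : R) (f : R -> \bar R) : 0 < c ->
  measurable_fun [set: R] f -> (forall x, 0 <= f x)%E ->
  (\int[@lebesgue_measure R]_x f x =
   \int[@lebesgue_measure R]_x (f (c * x)%R * c%:E))%E.
Proof.
move=> c0 mf f0.
have mc : measurable_fun [set: measurableTypeR R] (fun x : R => c * x : measurableTypeR R).
  by apply: measurable_funM.
have S (A : set R) : measurable A -> lebesgue_measure A =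
    mscale (NngNum (ltW c0)) (pushforward (@lebesgue_measure R) (fun x : R => c * x : measurableTypeR R)) A.
  move=> mA; apply: lebesgue_measure_unique => //= _ [[a b]] _ <-.
  rewrite /mscale /pushforward /=.
  rewrite (_ : pushforward _ _ _ = lebesgue_measure `]a / c, b / c]%classic); last first.
    congr (lebesgue_measure _).
    apply/seteqP; split=> x; rewrite /= !in_itv/=;
    by rewrite ltr_pdivrMr// ler_pdivlMr// (mulrC c).
  rewrite !lebesgue_measure_itv/= !lte_fin ltr_pM2r ?invr_gt0//.
  by case: ifPn => _; rewrite ?mule0// -!EFinB -EFinM -mulrBl mulrC divfK ?gt_eqF.
under [RHS]eq_integral do rewrite muleC.
rewrite ge0_integralZl_EFin ?ltW//; last first.
  exact: (measurableT_comp mf mc).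
have E := ge0_integral_pushforward mc (@lebesgue_measure R) measurableT mf
  (fun x _ => f0 x).
rewrite preimage_setT in E; rewrite -[X in (_ * X)%E]E.
rewrite -(ge0_integral_mscale _ _ (NngNum (ltW c0)))//.
by apply: eq_measure_integral => A mA _; exact: S.
Qed.

Lemma wT_Psi (R : realType) (al be ga de : R) (p : R * R) : square p ->
  wT al be ga de (Psi p) * (2 - p.2) = wQ al be ga de p.
Proof.
case: p => s t [/= /andP[s0 s1] /andP[t0 t1]]; rewrite /wT /wQ /w /Psi/=.
have c0 : 0 < 2 - t by lra.
(* Now both x and 2 - x - y carry a factor 2 - t, of total exponent ga + de; with the Jacobian this
   cancels the exponent -(ga + de + 1), since 2 - t > 0. *)
have -> : 2 - (2 - t) * s - t = (2 - t) * (1 - s) by ring.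
rewrite !powRM//; try lra.
have -> : - (ga + de + 1) = - ga - de - 1 by ring.
rewrite 2?powRB ?powRN ?powRr1 ?(ltW c0) ?(gt_eqF c0) ?implybT//.
have ? := powR_gt0 ga c0; have ? := powR_gt0 de c0.
by field; lra.
Qed.

Lemma squareE (R : realType) : @square R = @unit_itv R `*` @unit_itv R.
Proof.
by apply/seteqP; split=> p; rewrite /square /unit_itv /= !in_itv.
Qed.

Lemma measurable_square (R : realType) : measurable (@square R).
Proof. by rewrite squareE; apply: measurableX; exact: measurable_itv. Qed.

Lemma trapezoidE (R : realType) : @trapezoid R =
  ([set: R] `*` `[0, 1]%classic) `&` ((`[0, +oo[%classic `*` [set: R]) `&`
   (fun p : R * R => p.1 + p.2) @^-1` `]-oo, 2]%classic).
Proof.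
apply/seteqP; split=> -[x y]; rewrite /trapezoid/= !in_itv/= andbT.
  by move=> [y01 /andP[x0 x1]]; do !split => //; lra.
by move=> [[_ y01] [[x0 _] xy]]; split=> //; lra.
Qed.

Lemma measurable_trapezoid (R : realType) : measurable (@trapezoid R).
Proof.
rewrite trapezoidE; apply: measurableI; first exact: measurableX.
apply: measurableI; first exact: measurableX.
rewrite -[X in measurable X]setTI.
by apply: (measurable_funD measurable_fst measurable_snd).
Qed.

Lemma measurable_Psi (R : realType) (D : set (R * R)) : measurable_fun D (@Psi R).
Proof.
apply: (@measurable_funS _ _ _ _ setT) => //.
apply: measurable_fun_pair => //=.
apply: measurable_funM => //=; exact: measurable_funB.
Qed.

(** With y as the outer variable in Tonelli, each row of the trapezoid is a row of the square
    stretched by 2 - y > 0, so scaling on the line replaces a planar change of variables. Rows with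
    y outside [0, 1] contribute zero on both sides. *)
Lemma ge0_integral_trapezoid (R : realType) (F : R * R -> \bar R) :
  measurable_fun (@trapezoid R) F -> (forall p, 0 <= F p)%E ->
  (\int[@lebesgue2 R]_(p in @trapezoid R) F p =
   \int[@lebesgue2 R]_(p in @square R) (F (Psi p) * (2 - p.2)%:E))%E.
Proof.
move=> mF F0; have mT := @measurable_trapezoid R; have mQ := @measurable_square R.
rewrite integral_mkcond [RHS]integral_mkcond.
have mFQ : measurable_fun (@square R) (fun p => F (Psi p) * (2 - p.2)%:E)%E.
  apply: emeasurable_funM.
    apply: (measurable_comp mT _ mF); last exact: measurable_Psi.
    by move=> _ [p /Psi_trapezoid[+ _] <-].
  apply/measurable_EFinP; apply: (@measurable_funS _ _ _ _ setT) => //.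
  exact: measurable_funB.
rewrite /lebesgue2 fubini_tonelli2; last 2 first.
- exact/(measurable_restrictT _ mT).
- by move=> p; rewrite patchE; case: ifP.
rewrite fubini_tonelli2; last 2 first.
- exact/(measurable_restrictT _ mQ).
- move=> p; rewrite patchE; case: ifPn => // /[!inE] -[_ /andP[_ ?]].
  by rewrite mule_ge0// lee_fin; lra.
apply: eq_integral => y _; rewrite /fubini_G.
have [y01|y01] := boolP (0 <= y <= 1); last first.
  rewrite !integral0_eq// => x _; rewrite patchE memNset// => -[/= h1 h2].
    by rewrite h2 in y01.
  by rewrite h1 in y01.
have c0 : 0 < 2 - y by case/andP: y01; lra.
rewrite (ge0_integral_scale c0); last 2 first.
- apply: (measurable_comp (measurableT) _ ((measurable_restrictT _ mT).1 mF)) => //.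
- by move=> x; rewrite patchE; case: ifP.
apply: eq_integral => x _; rewrite !patchE.
have -> : ((2 - y) * x, y) = Psi (x, y) by [].
have -> : (Psi (x, y) \in @trapezoid R) = ((x, y) \in @square R).
  apply/idP/idP; rewrite !inE.
    by move=> /PsiV_square[+ _]; rewrite /PsiV/= mulrC mulKf ?gt_eqF.
  by move=> /Psi_trapezoid[].
by case: ifP; rewrite ?mul0e.
Qed.

Lemma compact_square (R : realType) : compact (@square R).
Proof. by rewrite squareE; apply: compact_setX; exact: segment_compact. Qed.

(** * Weighted integrals on the trapezoid and on the square *)

Section weighted.
Variables (R : realType) (al be ga de : R).
Hypotheses (hal : -1 < al) (hbe : -1 < be) (hga : -1 < ga) (hde : -1 < de).

Lemma integrable_wQ (c : R * R -> R) : {within @square R, continuous c} ->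
  (@lebesgue2 R).-integrable (@square R) (fun p => (c p * wQ al be ga de p)%:E).
Proof.
move=> cc; have [M cM] := within_compact_bounded (@compact_square R) cc.
apply: (@integrable_bounded_mul _ _ R (@lebesgue_measure R \x @lebesgue_measure R)%E
  (@square R) c (wQ al be ga de) M) => //.
- exact: measurable_square.
- exact: within_continuous_measurable (@measurable_square R) cc.
- rewrite squareE; have mI : measurable (@unit_itv R) by exact: measurable_itv.
  exact: (integrable_rectangle (m1 := lebesgue_measure) (m2 := lebesgue_measure)
    mI mI (w_ge0 ga de) (w_ge0 al be) (integrable_w hga hde) (integrable_w hal hbe)).
Qed.

Lemma measurable_wT (D : set (R * R)) : measurable_fun D (wT al be ga de).
Proof.
apply: (@measurable_funS _ _ _ _ setT) => //.
have P (c : R) (f : R * R -> R) : measurable_fun setT f ->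
    measurable_fun setT (fun p => f p `^ c).
  by move=> mf; apply: (measurableT_comp (measurable_powR c)).
do 4? apply: measurable_funM; apply: P => //.
- by do 2! apply: measurable_funB => //.
- exact: measurable_funB.
- exact: measurable_funB.
Qed.

Lemma wT_ge0 (p : R * R) : 0 <= wT al be ga de p.
Proof. by rewrite /wT; do 4! rewrite mulr_ge0 ?powR_ge0//. Qed.

Lemma ge0_integral_wT (u : R * R -> R) :
  measurable_fun (@trapezoid R) u -> (forall p, 0 <= u p) ->
  (\int[@lebesgue2 R]_(p in @trapezoid R) (u p * wT al be ga de p)%:E =
   \int[@lebesgue2 R]_(p in @square R) (u (Psi p) * wQ al be ga de p)%:E)%E.
Proof.
move=> mu u0; rewrite ge0_integral_trapezoid; last 2 first.
- by apply/measurable_EFinP/measurable_funM => //; exact: measurable_wT.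
- by move=> p; rewrite lee_fin mulr_ge0// wT_ge0.
apply: eq_integral => p /[!inE] Qp.
by rewrite -EFinM -mulrA wT_Psi.
Qed.

(** Finiteness concerns the integral of an absolute value, so the nonnegative case [ge0_integral_wT]
    is enough to import it from the square. *)
Lemma integrable_wT (u : R * R -> R) : {within @trapezoid R, continuous u} ->
  (@lebesgue2 R).-integrable (@trapezoid R) (fun p => (u p * wT al be ga de p)%:E).
Proof.
move=> cu; have mu := within_continuous_measurable (@measurable_trapezoid R) cu.
apply/integrableP; split.
  by apply/measurable_EFinP/measurable_funM => //; exact: measurable_wT.
have /integrableP[_] := integrable_wQ (within_continuous_Psi cu).
have E : (\int[@lebesgue2 R]_(p in @trapezoid R) `|(u p * wT al be ga de p)%:E| =
  \int[@lebesgue2 R]_(p in @square R) `|(u (Psi p) * wQ al be ga de p)%:E|)%E.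
  under eq_integral do rewrite /= normrM (ger0_norm (wT_ge0 _)).
  rewrite (@ge0_integral_wT (fun p => `|u p|)) //; last exact: measurableT_comp.
  apply: eq_integral => p _ /=.
  by rewrite normrM (ger0_norm (mulr_ge0 (w_ge0 _ _ _) (w_ge0 _ _ _))).
by rewrite [X in (_ -> X < _)%E]E.
Qed.

(** The weights are nonnegative, so the positive and negative parts of the weighted function are
    those of u times the weight; each is covered by the nonnegative case. *)
Lemma integral_wT (u : R * R -> R) : {within @trapezoid R, continuous u} ->
  (\int[@lebesgue2 R]_(p in @trapezoid R) (u p * wT al be ga de p)%:E =
   \int[@lebesgue2 R]_(p in @square R) (u (Psi p) * wQ al be ga de p)%:E)%E.
Proof.
move=> cu; have mu := within_continuous_measurable (@measurable_trapezoid R) cu.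
have mM (x y : R) : 0 <= y -> Num.max (x * y) 0 = Num.max x 0 * y.
  by move=> y0; rewrite maxr_pMl// mul0r.
rewrite integralE [RHS]integralE; congr (_ - _)%E.
- transitivity (\int[@lebesgue2 R]_(p in @trapezoid R)
    (Num.max (u p) 0 * wT al be ga de p)%:E)%E.
    by apply: eq_integral => p _; rewrite funeposE -EFin_max mM ?wT_ge0.
  rewrite (@ge0_integral_wT (fun p => Num.max (u p) 0)).
  + by apply: eq_integral => p _; rewrite funeposE -EFin_max mM// mulr_ge0 ?w_ge0.
  + exact: measurable_maxr.
  + by move=> p; rewrite le_max lexx orbT.
- transitivity (\int[@lebesgue2 R]_(p in @trapezoid R)
    (Num.max (- u p) 0 * wT al be ga de p)%:E)%E.
    by apply: eq_integral => p _; rewrite funenegE -EFinN -mulNr -EFin_max mM ?wT_ge0.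
  rewrite (@ge0_integral_wT (fun p => Num.max (- u p) 0)).
  + by apply: eq_integral => p _; rewrite funenegE -EFinN -mulNr -EFin_max mM// mulr_ge0 ?w_ge0.
  + by apply: measurable_maxr => //; exact: measurableT_comp.
  + by move=> p; rewrite le_max lexx orbT.
Qed.

End weighted.

(** * The energy form *)

Lemma within_continuous_PsiV (R : realType) (f : R * R -> R) :
  {within @square R, continuous f} ->
  {within @trapezoid R, continuous (f \o @PsiV R)}.
Proof.
move=> cf; apply: within_continuous_comp cf _; last by move=> p /PsiV_square[].
apply/subspace_continuousP => p [/andP[y0 y1] _]; apply: cvg_within_filter.
apply: (@cvg_pair _ _ _ _ (nbhs (p.1 / (2 - p.2))) (nbhs p.2)); last exact: cvg_snd.
apply: cvgM; first exact: cvg_fst.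
apply: cvgV; first by rewrite subr_eq0 gt_eqF//; lra.
by apply: cvgB; [exact: cvg_cst|exact: cvg_snd].
Qed.

Section energy.
Variables (R : realType) (al be ga de : R).
Hypotheses (hal : -1 < al) (hbe : -1 < be) (hga : -1 < ga) (hde : -1 < de).
Let T := @trapezoid R.
Let Q := @square R.
Let W := wT al be ga de.
Let W' := wQ al be ga de.

Lemma in_L2_trapezoid (u : R * R -> R) :
  {within T, continuous u} -> in_L2 T W u.
Proof.
move=> cu; split; first exact: within_continuous_measurable (@measurable_trapezoid R) cu.
by apply: integrable_wT => //; apply: within_continuousM.
Qed.

Lemma in_L2_square (u : R * R -> R) :
  {within Q, continuous u} -> in_L2 Q W' u.
Proof.
move=> cu; split; first exact: within_continuous_measurable (@measurable_square R) cu.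
by apply: integrable_wQ => //; apply: within_continuousM.
Qed.

Definition jacobi_s (f : R * R -> R) (p : R * R) : R :=
  - (p.1 * (1 - p.1) * Dss f p) - (ga + 1 - (ga + de + 2) * p.1) * Ds f p.

Definition jacobi_t (f : R * R -> R) (p : R * R) : R :=
  - (p.2 * (1 - p.2) * Dtt f p) - (al + 1 - (al + be + 2) * p.2) * Dt f p.

Lemma LQ_jacobi (f : R * R -> R) (p : R * R) : Ck 2 T f -> Q p ->
  LQ al be ga de (f \o @Psi R) p = jacobi_s f p + jacobi_t f p.
Proof. by move=> Cf; exact: LQ_Psi. Qed.

(** The Dirichlet form of the square in polarised form: its symmetry in f and h is the source of the
    symmetry of the operator. *)
Definition energy (f h : R * R -> R) (p : R * R) : R :=
  p.1 * (1 - p.1) * Ds f p * Ds h p + p.2 * (1 - p.2) * Dt f p * Dt h p.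

Lemma within_continuous_bubble1 (A : set (R * R)) :
  {within A, continuous (fun p : R * R => p.1 * (1 - p.1))}.
Proof.
have c1 := @within_continuous_fst R A; have cc := @within_continuous_cst R A.
by apply: within_continuousM => //; exact: within_continuousB.
Qed.

Lemma within_continuous_bubble2 (A : set (R * R)) :
  {within A, continuous (fun p : R * R => p.2 * (1 - p.2))}.
Proof.
have c1 := @within_continuous_snd R A; have cc := @within_continuous_cst R A.
by apply: within_continuousM => //; exact: within_continuousB.
Qed.

Lemma jacobi_s_continuous (f : R * R -> R) : Ck 2 T f ->
  {within Q, continuous (jacobi_s f)}.
Proof.
move=> Cf; have c1 := @within_continuous_fst R Q; have cc := @within_continuous_cst R Q.
apply: within_continuousB.
  apply/within_continuousN/within_continuousM; last exact: Dss_continuous.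
  exact: within_continuous_bubble1.
apply: within_continuousM; last exact: Ds_continuous Cf.
by apply: within_continuousB => //; exact: within_continuousM.
Qed.

Lemma jacobi_t_continuous (f : R * R -> R) : Ck 2 T f ->
  {within Q, continuous (jacobi_t f)}.
Proof.
move=> Cf; have c1 := @within_continuous_snd R Q; have cc := @within_continuous_cst R Q.
apply: within_continuousB.
  apply/within_continuousN/within_continuousM; last exact: Dtt_continuous.
  exact: within_continuous_bubble2.
apply: within_continuousM; last exact: Dt_continuous Cf.
by apply: within_continuousB => //; exact: within_continuousM.
Qed.

Lemma LQ_continuous (f : R * R -> R) : Ck 2 T f ->
  {within Q, continuous (LQ al be ga de (f \o @Psi R))}.
Proof.
move=> Cf.
have : {within Q, continuous (fun p => jacobi_s f p + jacobi_t f p)}.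
  by apply: within_continuousD; [exact: jacobi_s_continuous|exact: jacobi_t_continuous].
apply: subspace_eq_continuous => p /[!inE] Qp.
by rewrite /from_subspace LQ_jacobi.
Qed.

Lemma LT_continuous (f : R * R -> R) : Ck 2 T f ->
  {within T, continuous (LT al be ga de f)}.
Proof. by move=> Cf; apply: within_continuous_PsiV; exact: LQ_continuous. Qed.

Lemma energy_s_continuous (f h : R * R -> R) : Ck 2 T f -> Ck 2 T h ->
  {within Q, continuous (fun p => p.1 * (1 - p.1) * Ds f p * Ds h p)}.
Proof.
move=> Cf Ch; apply: within_continuousM; last exact: Ds_continuous Ch.
apply: within_continuousM; last exact: Ds_continuous Cf.
exact: within_continuous_bubble1.
Qed.

Lemma energy_t_continuous (f h : R * R -> R) : Ck 2 T f -> Ck 2 T h ->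
  {within Q, continuous (fun p => p.2 * (1 - p.2) * Dt f p * Dt h p)}.
Proof.
move=> Cf Ch; apply: within_continuousM; last exact: Dt_continuous Ch.
apply: within_continuousM; last exact: Dt_continuous Cf.
exact: within_continuous_bubble2.
Qed.

Lemma integral_jacobi_s (f h : R * R -> R) : Ck 2 T f -> Ck 2 T h ->
  (\int[@lebesgue2 R]_(p in Q) (jacobi_s f p * h (Psi p) * W' p)%:E =
   \int[@lebesgue2 R]_(p in Q) (p.1 * (1 - p.1) * Ds f p * Ds h p * W' p)%:E)%E.
Proof.
move=> Cf Ch.
have chP := within_continuous_Psi (Ck_continuous Ch).
have i1 : (@lebesgue2 R).-integrable Q (fun p => (jacobi_s f p * h (Psi p) * W' p)%:E).
  by apply: integrable_wQ => //; apply: within_continuousM => //; exact: jacobi_s_continuous.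
have i2 := integrable_wQ hal hbe hga hde (energy_s_continuous Cf Ch).
have mI : measurable (@unit_itv R) by exact: measurable_itv.
move: i1 i2; rewrite /Q squareE => i1 i2.
apply: (eq_integral_rectangle_fst (m1 := lebesgue_measure) (m2 := lebesgue_measure) mI mI i1 i2).
move=> t; rewrite /unit_itv/= in_itv => t01.
(* On a row the weight in t is a constant, absorbed into the test function so that only the weight
   in s is left for [jacobi_parts]. It is a real number on the edge rows too, where a power of 0
   takes its conventional value. *)
pose k := w al be t.
have ck : {within @unit_itv R, continuous (fun _ : R => k)}.
  by apply: continuous_subspaceT => x; exact: cvg_cst.
have cs g : Ck 2 T g -> {within @unit_itv R, continuous (fun s => Ds g (s, t))}.
  by move=> Cg; apply: within_square_fst t01 (Ds_continuous Cg).
have := @jacobi_parts R ga de (fun s => Ds f (s, t)) (fun s => Dss f (s, t))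
  (fun s => h (Psi (s, t)) * k) (fun s => Ds h (s, t) * k) hga hde.
move=> /(_ (cs _ Cf) (within_square_fst t01 (Dss_continuous Cf))).
move=> /(_ (within_continuousM (within_square_fst t01 chP) ck)).
move=> /(_ (within_continuousM (cs _ Ch) ck)).
have d1 (s : R) : 0 < s < 1 -> is_derive s 1 (fun s => Ds f (s, t)) (Dss f (s, t)).
  by move=> s01; exact: (is_derive_Dss Cf s01 t01).
have d2 (s : R) : 0 < s < 1 ->
    is_derive s 1 (fun s => h (Psi (s, t)) * k) (Ds h (s, t) * k).
  move=> s01; have D := is_derive_Ds Ch s01 t01.
  under eq_fun do rewrite mulrC; rewrite mulrC; exact: (is_deriveZ k D).
move=> /(_ d1 d2) E.
transitivity (\int[@lebesgue_measure R]_(s in @unit_itv R) (jacobi_s f (s, t) *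
   (h (Psi (s, t)) * k) * w ga de s)%:E)%E.
  apply: eq_integral => s _; congr EFin; rewrite /W' /wQ /= -/k.
  by move: (jacobi_s f _) (h _) (w ga de s) => ? ? ?; ring.
rewrite [LHS]E; apply: eq_integral => s _; congr EFin; rewrite /W' /wQ /= -/k.
by move: (Ds f _) (Ds h _) (w ga de s) => ? ? ?; ring.
Qed.

Lemma integral_jacobi_t (f h : R * R -> R) : Ck 2 T f -> Ck 2 T h ->
  (\int[@lebesgue2 R]_(p in Q) (jacobi_t f p * h (Psi p) * W' p)%:E =
   \int[@lebesgue2 R]_(p in Q) (p.2 * (1 - p.2) * Dt f p * Dt h p * W' p)%:E)%E.
Proof.
move=> Cf Ch.
have chP := within_continuous_Psi (Ck_continuous Ch).
have i1 : (@lebesgue2 R).-integrable Q (fun p => (jacobi_t f p * h (Psi p) * W' p)%:E).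
  by apply: integrable_wQ => //; apply: within_continuousM => //; exact: jacobi_t_continuous.
have i2 := integrable_wQ hal hbe hga hde (energy_t_continuous Cf Ch).
have mI : measurable (@unit_itv R) by exact: measurable_itv.
move: i1 i2; rewrite /Q squareE => i1 i2.
apply: (eq_integral_rectangle_snd (m1 := lebesgue_measure) (m2 := lebesgue_measure) mI mI i1 i2).
move=> s; rewrite /unit_itv/= in_itv => s01.
pose k := w ga de s.
have ck : {within @unit_itv R, continuous (fun _ : R => k)}.
  by apply: continuous_subspaceT => x; exact: cvg_cst.
have cs g : Ck 2 T g -> {within @unit_itv R, continuous (fun t => Dt g (s, t))}.
  by move=> Cg; apply: within_square_snd s01 (Dt_continuous Cg).
have := @jacobi_parts R al be (fun t => Dt f (s, t)) (fun t => Dtt f (s, t))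
  (fun t => h (Psi (s, t)) * k) (fun t => Dt h (s, t) * k) hal hbe.
move=> /(_ (cs _ Cf) (within_square_snd s01 (Dtt_continuous Cf))).
move=> /(_ (within_continuousM (within_square_snd s01 chP) ck)).
move=> /(_ (within_continuousM (cs _ Ch) ck)).
have d1 (t : R) : 0 < t < 1 -> is_derive t 1 (fun t => Dt f (s, t)) (Dtt f (s, t)).
  by move=> t01; exact: (is_derive_Dtt Cf s01 t01).
have d2 (t : R) : 0 < t < 1 ->
    is_derive t 1 (fun t => h (Psi (s, t)) * k) (Dt h (s, t) * k).
  move=> t01; have D := is_derive_Dt Ch s01 t01.
  under eq_fun do rewrite mulrC; rewrite mulrC; exact: (is_deriveZ k D).
move=> /(_ d1 d2) E.
transitivity (\int[@lebesgue_measure R]_(t in @unit_itv R) (jacobi_t f (s, t) *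
   (h (Psi (s, t)) * k) * w al be t)%:E)%E.
  apply: eq_integral => t _; congr EFin; rewrite /W' /wQ /= -/k.
  by move: (jacobi_t f _) (h _) (w al be t) => ? ? ?; ring.
rewrite [LHS]E; apply: eq_integral => t _; congr EFin; rewrite /W' /wQ /= -/k.
by move: (Dt f _) (Dt h _) (w al be t) => ? ? ?; ring.
Qed.

Lemma inner_LQ (f h : R * R -> R) : Ck 2 T f -> Ck 2 T h ->
  inner Q W' (LQ al be ga de (f \o @Psi R)) (h \o @Psi R) =
  \int[@lebesgue2 R]_(p in Q) (energy f h p * W' p).
Proof.
move=> Cf Ch; have mQ := @measurable_square R.
have chP := within_continuous_Psi (Ck_continuous Ch).
rewrite /inner /Rintegral; congr fine.
transitivity (\int[@lebesgue2 R]_(p in Q) ((jacobi_s f p * h (Psi p) * W' p)%:E +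
   (jacobi_t f p * h (Psi p) * W' p)%:E))%E.
  by apply: eq_integral => p /[!inE] Qp; rewrite LQ_jacobi// !mulrDl EFinD.
rewrite integralD//; last 2 first.
- by apply: integrable_wQ => //; apply: within_continuousM => //; exact: jacobi_s_continuous.
- by apply: integrable_wQ => //; apply: within_continuousM => //; exact: jacobi_t_continuous.
rewrite integral_jacobi_s// integral_jacobi_t// -integralD//; last 2 first.
- exact: integrable_wQ (energy_s_continuous Cf Ch).
- exact: integrable_wQ (energy_t_continuous Cf Ch).
by apply: eq_integral => p _; rewrite -EFinD -mulrDl.
Qed.

Lemma inner_trapezoid (u v : R * R -> R) :
  {within T, continuous u} -> {within T, continuous v} ->
  inner T W u v = inner Q W' (u \o @Psi R) (v \o @Psi R).
Proof.
by move=> cu cv; congr fine; apply: (integral_wT _ _ _ _ (within_continuousM cu cv)).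
Qed.

Lemma LT_Psi (f : R * R -> R) (p : R * R) : Q p ->
  LT al be ga de f (Psi p) = LQ al be ga de (f \o @Psi R) p.
Proof. by move=> /Psi_trapezoid[_]; rewrite /LT /= => ->. Qed.

Lemma inner_LT (f h : R * R -> R) : Ck 2 T f -> Ck 2 T h ->
  inner T W (LT al be ga de f) h =
  inner Q W' (LQ al be ga de (f \o @Psi R)) (h \o @Psi R).
Proof.
move=> Cf Ch; rewrite inner_trapezoid; [|exact: LT_continuous|exact: Ck_continuous Ch].
by apply: eq_Rintegral => p /[!inE] Qp /=; rewrite LT_Psi.
Qed.

Lemma innerC (D : set (R * R)) (V u v : R * R -> R) :
  inner D V u v = inner D V v u.
Proof. by apply: eq_Rintegral => p _; rewrite (mulrC (u p)). Qed.

Lemma energyC (f h : R * R -> R) (p : R * R) : energy f h p = energy h f p.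
Proof. exact: (congr2 +%R (mulrAC _ _ _) (mulrAC _ _ _)). Qed.

Lemma energy_ge0 (f : R * R -> R) (p : R * R) : Q p -> 0 <= energy f f p.
Proof.
move=> [/andP[s0 s1] /andP[t0 t1]].
have H (x y : R) : 0 <= x -> 0 <= x * y * y.
  by move=> x0; rewrite -mulrA mulr_ge0// -expr2 sqr_ge0.
by apply: addr_ge0; apply: H; rewrite mulr_ge0 ?subr_ge0.
Qed.

Lemma Phix_dx_continuous (f : R * R -> R) : Ck 2 T f ->
  {within T, continuous (fun p => Phix p * dx f p)}.
Proof.
move=> Cf; have c1 := @within_continuous_fst R T; have c2 := @within_continuous_snd R T.
have cc := @within_continuous_cst R T.
apply: within_continuousM; last exact/Ck_continuous/Ck_cderive1/Cf.
move=> p; apply: (@continuous_comp (subspace T) R R _ (@Num.sqrt R)); last exact: sqrt_continuous.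
by apply: within_continuousM => //; do 2! apply: within_continuousB => //.
Qed.

Lemma Phiy_Dy_continuous (f : R * R -> R) : Ck 2 T f ->
  {within T, continuous (fun p => Phiy p * Dy f p)}.
Proof.
move=> Cf; apply: within_continuousM.
  move=> p; apply: (@continuous_comp (subspace T) R R _ (@Num.sqrt R)); last exact: sqrt_continuous.
  exact: within_continuous_bubble2.
apply: within_continuousB; first exact/Ck_continuous/Ck_cderive2/Cf.
apply: within_continuousM; last exact/Ck_continuous/Ck_cderive1/Cf.
apply: (@within_continuous_PsiV _ fst); exact: within_continuous_fst.
Qed.

Lemma integral_Phix (f : R * R -> R) : Ck 2 T f ->
  \int[@lebesgue2 R]_(p in T) (`|Phix p * dx f p| ^+ 2 * W p) =
  \int[@lebesgue2 R]_(p in Q) (p.1 * (1 - p.1) * Ds f p * Ds f p * W' p).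
Proof.
move=> Cf; have cu := Phix_dx_continuous Cf; rewrite /Rintegral; congr fine.
transitivity (\int[@lebesgue2 R]_(p in T) ((Phix p * dx f p) * (Phix p * dx f p) * W p)%:E)%E.
  by apply: eq_integral => p _; rewrite real_normK ?num_real// expr2.
rewrite (integral_wT al be ga de (within_continuousM cu cu)).
apply: eq_integral => -[s t] /[!inE] -[/= /andP[s0 s1] /andP[t0 t1]].
(* Under Psi the radicand x (2 - x - y) becomes (2 - t)^2 s (1 - s); one factor 2 - t goes into each
   copy of [Ds f]. Its nonnegativity on the square is what lets the square root be squared away. *)
congr (_ * _)%:E; rewrite mulrACA -expr2 sqr_sqrtr/=.
  by rewrite /Ds/=; ring.
have -> : 2 - (2 - t) * s - t = (2 - t) * (1 - s) by ring.
by do 2? apply: mulr_ge0; lra.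
Qed.

Lemma integral_Phiy (f : R * R -> R) : Ck 2 T f ->
  \int[@lebesgue2 R]_(p in T) (`|Phiy p * Dy f p| ^+ 2 * W p) =
  \int[@lebesgue2 R]_(p in Q) (p.2 * (1 - p.2) * Dt f p * Dt f p * W' p).
Proof.
move=> Cf; have cu := Phiy_Dy_continuous Cf; rewrite /Rintegral; congr fine.
transitivity (\int[@lebesgue2 R]_(p in T) ((Phiy p * Dy f p) * (Phiy p * Dy f p) * W p)%:E)%E.
  by apply: eq_integral => p _; rewrite real_normK ?num_real// expr2.
rewrite (integral_wT al be ga de (within_continuousM cu cu)).
apply: eq_integral => -[s t] /[!inE] -[/= /andP[s0 s1] /andP[t0 t1]].
congr (_ * _)%:E; rewrite mulrACA -expr2 sqr_sqrtr/=; last by apply: mulr_ge0; lra.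
have -> : Dy f (Psi (s, t)) = Dt f (s, t).
  have c : (2 - t) * s / (2 - t) = s by field; lra.
  by rewrite /Dy /Dt/= c.
by rewrite mulrA.
Qed.

End energy.

Unset Implicit Arguments.

Theorem proposition4p1 (R : realType) (al be ga de : R)
    (hal : -1 < al) (hbe : -1 < be) (hga : -1 < ga) (hde : -1 < de)
    (f h : R * R -> R)
    (hf : Ck 2 (@trapezoid R) f) (hh : Ck 2 (@trapezoid R) h) :
  let T := @trapezoid R in
  let Q := @square R in
  let W := wT al be ga de in
  let W' := wQ al be ga de in
  let g := f \o @Psi R in
  let q := h \o @Psi R in
  ([/\ in_L2 T W f, in_L2 T W (LT al be ga de f),
       in_L2 Q W' g & in_L2 Q W' (LQ al be ga de g)] /\
   [/\ in_L2 T W h, in_L2 T W (LT al be ga de h),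
       in_L2 Q W' q & in_L2 Q W' (LQ al be ga de q)] /\
   in_L2 T W (fun p => Phix p * dx f p) /\
   in_L2 T W (fun p => Phiy p * Dy f p)) /\
  [/\ inner T W (LT al be ga de f) h = inner Q W' (LQ al be ga de g) q,
      inner T W (LT al be ga de f) h = inner T W f (LT al be ga de h),
      0 <= inner T W (LT al be ga de f) f &
      inner T W (LT al be ga de f) f =
        \int[@lebesgue2 R]_(p in T) (`|Phix p * dx f p| ^+ 2 * W p) +
        \int[@lebesgue2 R]_(p in T) (`|Phiy p * Dy f p| ^+ 2 * W p)].
Proof.
move=> T Q W W' g q.
have L2 u (Cu : Ck 2 T u) : [/\ in_L2 T W u, in_L2 T W (LT al be ga de u),
    in_L2 Q W' (u \o @Psi R) & in_L2 Q W' (LQ al be ga de (u \o @Psi R))].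
  split.
  - apply: in_L2_trapezoid => //; exact: Ck_continuous Cu.
  - by apply: in_L2_trapezoid => //; exact: LT_continuous.
  - by apply: in_L2_square => //; exact/within_continuous_Psi/Ck_continuous/Cu.
  - by apply: in_L2_square => //; exact: LQ_continuous.
have E u v (Cu : Ck 2 T u) (Cv : Ck 2 T v) : inner T W (LT al be ga de u) v =
    \int[@lebesgue2 R]_(p in Q) (energy u v p * W' p).
  exact: etrans (inner_LT al be ga de Cu Cv) (inner_LQ hal hbe hga hde Cu Cv).
have Lx : in_L2 T W (fun p => Phix p * dx f p).
  by apply: in_L2_trapezoid => //; exact: Phix_dx_continuous.
have Ly : in_L2 T W (fun p => Phiy p * Dy f p).
  by apply: in_L2_trapezoid => //; exact: Phiy_Dy_continuous.
split; first exact: (conj (L2 f hf) (conj (L2 h hh) (conj Lx Ly))).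
split.
- exact: inner_LT.
(* Swapping the arguments on the right puts the operator first on both sides, which then are
   energies with f and h exchanged. *)
- rewrite (E f h hf hh) [RHS]innerC (E h f hh hf); apply: eq_Rintegral => p _.
  by rewrite energyC.
- rewrite (E f f hf hf); apply: Rintegral_ge0 => p Qp.
  by rewrite mulr_ge0 ?energy_ge0// mulr_ge0 ?w_ge0.
- rewrite (E f f hf hf) (integral_Phix al be ga de hf) (integral_Phiy al be ga de hf) -RintegralD.
  + by apply: eq_Rintegral => p _; rewrite -mulrDl.
  + exact: measurable_square.
  + exact: integrable_wQ (energy_s_continuous hf hf).
  + exact: integrable_wQ (energy_t_continuous hf hf).
Qed.
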